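(* Let $G$ be a C3CBP of order greater than $8$. Then there exists a C3CBP $G'$ such that $G(R_0)G'$ or $G(R_4)G'$; that is, $G'$ is obtained from $G$ by one application of the reduction $R_0$ or one application of the reduction $R_4$.
   Context: A C3CBP is a cubic, $3$-connected, bipartite, planar graph. A graph is $3$-connected if it has more than $3$ vertices and deleting any set of fewer than $3$ vertices leaves a connected graph. The order of a graph is its number of vertices. $G(R)G'$ means that $G'$ is obtained from $G$ by one application of reduction $R$. Reduction $R_0$: let $a_1a_2a_3a_4$ be a face of length $4$ (with $a_i$ adjacent to $a_{i+1}$, indices modulo $4$) and let $b_i$ be the third neighbour of $a_i$, outside the face. Delete $a_1,a_2,a_3,a_4$ and add either the two edges $b_1b_2$ and $b_3b_4$, or the two edges $b_2b_3$ and $b_4b_1$. These are the two possible applications of $R_0$ to the given $4$-face. Reduction $R_4$: let $j,h_1,h_2,h_3,x_1,x_2,x_3$ be seven vertices inducing a subgraph (a cube minus one vertex) whose edges are $jh_1,jh_2,jh_3$ and $x_1h_1,x_1h_2,x_2h_1,x_2h_3,x_3h_2,x_3h_3$, and let $y_i$ be the neighbour of $x_i$ outside this set. Delete the seven vertices and add one new vertex adjacent to $y_1,y_2,y_3$. *)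

(* Defs.v *)
From HB Require Import structures.
From mathcomp Require Import all_boot.

Set Implicit Arguments.
Unset Strict Implicit.
Unset Printing Implicit Defensive.

Record sgraph := SGraph {
  vertex :> finType;
  adj : rel vertex;
  adj_sym : symmetric adj;
  adj_irrefl : irreflexive adj
}.

Definition rel_iso (T T' : finType) (r : rel T) (r' : rel T') : Prop :=
  exists2 f : T -> T', bijective f & forall x y, r' (f x) (f y) = r x y.

Section Graph.

Variable G : sgraph.

Definition cubic : Prop := forall x : G, #|[set y | adj x y]| = 3.

Definition bipartite : Prop :=
  exists c : G -> bool, forall x y, adj x y -> c x != c y.

Definition connected : Prop := forall x y : G, connect (@adj G) x y.

Definition del_vertex (S : {set G}) : finType := {x : G | x \notin S}.

Definition del_adj (S : {set G}) : rel (del_vertex S) :=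
  fun x y => adj (val x) (val y).

Lemma del_adj_sym (S : {set G}) : symmetric (@del_adj S).
Proof. by move=> x y; apply: adj_sym. Qed.

Lemma del_adj_irrefl (S : {set G}) : irreflexive (@del_adj S).
Proof. by move=> x; apply: adj_irrefl. Qed.

Definition delete (S : {set G}) : sgraph :=
  SGraph (@del_adj_sym S) (@del_adj_irrefl S).

(* Planarity is that of combinatorial maps: an embedding in an orientable     *)
(* surface is a rotation system on the darts (ordered pairs of adjacent       *)
(* vertices), and the surface is a union of spheres iff Euler's formula holds. *)
Definition dart : finType := {p : G * G | adj p.1 p.2}.

Definition tail (d : dart) : G := (val d).1.

Lemma rev_proof (d : dart) : adj (val d).2 (val d).1.
Proof. by rewrite adj_sym (valP d). Qed.

Definition rev (d : dart) : dart :=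
  exist (fun p : G * G => adj p.1 p.2) ((val d).2, (val d).1) (rev_proof d).

(* The orbits of a rotation are exactly the sets of darts with a common tail. *)
Definition rotation (rot : dart -> dart) : Prop :=
  injective rot /\ forall d d', fconnect rot d d' = (tail d == tail d').

(* A face is traversed by following a dart (u, v) to v and leaving v along    *)
(* the dart that comes after (v, u) in the rotation at v.                     *)
Definition face_step (rot : dart -> dart) (d : dart) : dart := rot (rev d).

Definition dart_link (rot : dart -> dart) : rel dart :=
  fun d d' => (rev d == d') || (rot d == d').

(* V + E + F = 2 E + 2 C, where #|dart| = 2 E. Counting orbits of darts       *)
(* ignores isolated vertices, both in V and in C.                             *)
Definition euler_sphere (rot : dart -> dart) : Prop :=
  fcard rot dart + fcard rev dart + fcard (face_step rot) dart
    = #|dart| + 2 * n_comp (dart_link rot) dart.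

Definition planar_embedding (rot : dart -> dart) : Prop :=
  rotation rot /\ euler_sphere rot.

Definition planar : Prop := exists rot, planar_embedding rot.

(* The cyclic sequence of vertices s bounds a face of the embedding rot.      *)
Definition is_face (rot : dart -> dart) (s : seq G) : Prop :=
  exists2 c : seq dart, ufcycle (face_step rot) c & map tail c = s.

End Graph.

Definition three_connected (G : sgraph) : Prop :=
  3 < #|G| /\ forall S : {set G}, #|S| < 3 -> connected (delete S).

Definition C3CBP (G : sgraph) : Prop :=
  [/\ cubic G, three_connected G, bipartite G & planar G].

Definition same_edge (T : eqType) (x y u v : T) : bool :=
  ((x == u) && (y == v)) || ((x == v) && (y == u)).

Definition add2 (G : sgraph) (S : {set G}) (u v w z : G) :
    rel (delete S) :=
  fun x y => [|| adj x y, same_edge (val x) (val y) u v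
               | same_edge (val x) (val y) w z].

(* Faces of G are those of a planar embedding of G; for 3-connected G that    *)
(* embedding is unique up to reflection. If an added edge is a loop, no       *)
(* simple graph G' satisfies rel_iso; if it is parallel to another edge, it   *)
(* is merged with it and, G being cubic, G' is then not cubic.                *)
Definition R0 (G G' : sgraph) : Prop :=
  exists (rot : dart G -> dart G) (a1 a2 a3 a4 b1 b2 b3 b4 : G),
    let S := [set a1; a2; a3; a4] in
    [/\ planar_embedding rot,
        is_face rot [:: a1; a2; a3; a4] /\ uniq [:: a1; a2; a3; a4],
        [/\ adj a1 b1, adj a2 b2, adj a3 b3 & adj a4 b4],
        [/\ b1 \notin S, b2 \notin S, b3 \notin S & b4 \notin S]
      & rel_iso (@adj G') (@add2 G S b1 b2 b3 b4)
        \/ rel_iso (@adj G') (@add2 G S b2 b3 b4 b1)].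

Definition add_vertex (G : sgraph) (S N : {set G}) :
    rel (option (delete S)) :=
  fun x y => match x, y with
    | Some u, Some v => adj u v
    | Some u, None | None, Some u => val u \in N
    | None, None => false
    end.

(* If two of the y_i coincide, the new vertex has degree less than 3, so that *)
(* G' is not cubic.                                                           *)
Definition R4 (G G' : sgraph) : Prop :=
  exists j h1 h2 h3 x1 x2 x3 y1 y2 y3 : G,
    let s := [:: j; h1; h2; h3; x1; x2; x3] in
    let E := [:: (j, h1); (j, h2); (j, h3); (x1, h1); (x1, h2);
                 (x2, h1); (x2, h3); (x3, h2); (x3, h3)] in
    let S := [set v in s] in
    [/\ uniq s,
        {in s &, forall u v, adj u v = ((u, v) \in E) || ((v, u) \in E)},
        [/\ adj x1 y1, adj x2 y2 & adj x3 y3],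
        [/\ y1 \notin S, y2 \notin S & y3 \notin S]
      & rel_iso (@adj G') (@add_vertex G S [set y1; y2; y3])].

(* Main.v *)
(* A cubic graph is 3-connected iff it is 3-edge-connected, so everything is
   phrased with edge cuts. Among the sides of 3-edge-cuts with at least two
   vertices take a minimal one, P. Euler's formula, together with the bound of
   the number of faces inside a part of the graph by the dimension of its cycle
   space, gives a 4-face a1 a2 a3 a4 inside P. If an application of R_0 to it
   fails, there is a 4-edge-cut through two opposite edges of the face. If both
   fail, uncrossing the two cuts shows that G is a cube with the vertices
   b1, b2, b3, b4 opened up into parts Q_i with 3-edge-cuts; planarity is not
   needed here. Uncrossing the Q_i with P and minimality of P make three of the
   b_i consecutive on a path, so R_4 applies to a1, ..., a4 and these b_i. The
   result of R_4 is the contraction of one side of a 3-edge-cut to a vertex; its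
   rotation at the new vertex is read off the three faces crossing the cut. *)

Require Import Defs.
From mathcomp Require Import all_boot.
From mathcomp Require Import all_algebra.
From mathcomp Require Import zify.
(* [seq.rev] would otherwise hide the reversal of darts. *)
Import Defs.

Set Implicit Arguments.
Unset Strict Implicit.
Unset Printing Implicit Defensive.

(** * Edge cuts *)

(** Combinatorial maps come without a Jordan curve theorem; its substitute here is the tightness of
    one inequality. For every rotation of a nonempty 3-edge-connected cubic bipartite graph with V
    vertices and F faces, independence of the face boundaries gives 2F <= V + 4, and Euler's formula
    says that equality holds. For a 3-edge-cut with sides X and Y the same argument allows at most
    (|X| - 1)/2 faces inside X and (|Y| - 1)/2 inside Y, and at most three faces cross the cut.
    These bounds add up to exactly V/2 + 2, so all of them are attained. Hence the three crossing
    faces are distinct, and the faces inside X have average length below 6, which together with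
    evenness yields a 4-face. The inequality also reduces planarity of a reduced graph to exhibiting
    enough faces. Minimality of P is needed because the corners Q_i of the opened cube can be
    arbitrarily large in general. A Q_i that does not contain the complement of P meets P in at most
    one vertex, and a degree count over P then leaves exactly three of the b_i in P. *)

Section EdgeCount.

Variable G : sgraph.
Implicit Types (A B C S : {set G}) (x y : G).

(** The count is over ordered pairs: an edge inside [A] contributes 2 to [edges A A], so that
    [edges A A + edges A (~: A)] is the degree sum over [A]. *)
Definition edges A B : nat := \sum_(x in A) \sum_(y in B) @adj G x y.

Lemma edgesC A B : edges A B = edges B A.
Proof.
rewrite /edges exchange_big /=.
by apply: eq_bigr => x _; apply: eq_bigr => y _; rewrite adj_sym.
Qed.

Lemma edgesID C A B : edges A B = edges (A :&: C) B + edges (A :\: C) B.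
Proof. by rewrite /edges (big_setID C). Qed.

Lemma edgesUl A1 A2 B : [disjoint A1 & A2] ->
  edges (A1 :|: A2) B = edges A1 B + edges A2 B.
Proof. move=> dA; rewrite (edgesID A1) setUK setDUl setDv set0U.
by congr (_ + edges _ B); apply/setDidPl; rewrite disjoint_sym. Qed.

Lemma edgesUr A1 A2 B : [disjoint A1 & A2] ->
  edges B (A1 :|: A2) = edges B A1 + edges B A2.
Proof. by move=> dA; rewrite !(edgesC B) edgesUl. Qed.

Lemma edges0 A : edges set0 A = 0.
Proof. by rewrite /edges big_set0. Qed.

Lemma edges11 x y : edges [set x] [set y] = adj x y.
Proof. by rewrite /edges !big_set1. Qed.

Lemma edgesS A A' B B' : A \subset A' -> B \subset B' -> edges A B <= edges A' B'.
Proof.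
move=> sA sB; have mono C1 C2 D : C1 \subset C2 -> edges C1 D <= edges C2 D.
  by move=> sC; rewrite (edgesID C1 C2) (setIidPr sC) leq_addr.
by apply: (leq_trans (mono _ _ _ sA)); rewrite edgesC (edgesC A') mono.
Qed.

Lemma edges_gt0 A B x y : x \in A -> y \in B -> adj x y -> 0 < edges A B.
Proof.
move=> xA yB xy; apply: (@leq_trans (edges [set x] [set y])).
  by rewrite edges11 xy.
by apply: edgesS; rewrite sub1set.
Qed.

Lemma edges_gt0P A B : 0 < edges A B -> exists x y, [/\ x \in A, y \in B & adj x y].
Proof.
rewrite lt0n /edges sum_nat_eq0 => /forall_inPn [x xA].
rewrite sum_nat_eq0 => /forall_inPn [y yB].
by case xy: (adj x y) => // _; exists x, y.
Qed.

Lemma edges_eq0 A B : (forall x y, x \in A -> y \in B -> adj x y -> False) ->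
  edges A B = 0.
Proof.
move=> noE; rewrite /edges big1 // => x xA; rewrite big1 // => y yB.
by case xy: (adj x y) => //; case: (noE x y).
Qed.

Lemma edges1_card x B : edges [set x] B = #|[set y in B | adj x y]|.
Proof.
rewrite /edges big_set1 -sum1_card big_mkcond [RHS]big_mkcond.
by apply: eq_bigr => y _; rewrite inE; case: (y \in B); case: (adj x y).
Qed.

Lemma edges_sum A B : edges A B = \sum_(x in A) edges [set x] B.
Proof. by apply: eq_bigr => x _; rewrite /edges big_set1. Qed.

Lemma edges1_self x A : edges [set x] A <= #|A :\ x|.
Proof.
rewrite edges1_card; apply/subset_leq_card/subsetP => y.
rewrite !inE => /andP [-> xy]; rewrite andbT.
by apply: contraTneq xy => ->; rewrite adj_irrefl.
Qed.

Lemma edges_card_le A B : edges A B <= #|A| * #|B|.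
Proof.
rewrite edges_sum -sum_nat_const; apply: leq_sum => x _.
by rewrite (leq_trans (edges1_self x B)) // subset_leq_card ?subD1set.
Qed.

Definition cut3 : Prop :=
  forall A, A != set0 -> A != setT -> 3 <= edges A (~: A).

Hypothesis hcub : cubic G.

Lemma edges_setT A : edges A setT = 3 * #|A|.
Proof.
rewrite edges_sum mulnC -sum_nat_const; apply: eq_bigr => x _.
by rewrite edges1_card -(hcub x); apply: eq_card => y; rewrite !inE.
Qed.

Lemma edges_split A B : edges A B + edges A (~: B) = 3 * #|A|.
Proof. by rewrite -edges_setT -edgesUr ?setUCr // -setI_eq0 setICr. Qed.

Lemma cubic_card_gt3 (x : G) : 3 < #|G|.
Proof.
have := subset_leq_card (subsetT (x |: [set y | adj x y])).
by rewrite cardsU1 hcub inE adj_irrefl cardsT.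
Qed.

(** The ends in [A] of fewer than three cut edges form a set [U] of fewer than three vertices that
    separates [A :\: U] from the complement of [A]. If [A] is contained in [U], it has at most two
    vertices, and its cut has at least [|A| (4 - |A|)], hence at least 3, edges by the degree
    sum. *)
Lemma three_connected_cut3 : three_connected G -> cut3.
Proof.
move=> [_ conn] A /set0Pn [a0 a0A] AT; rewrite leqNgt; apply/negP => lt3.
pose U := [set x in A | [exists y, (y \notin A) && adj x y]].
have leU : #|U| <= edges A (~: A).
  rewrite edges_sum (big_setID U) /= -sum1_card.
  have -> : A :&: U = U by apply/setIidPr/subsetP => x; rewrite inE => /andP [].
  apply: leq_trans (leq_addr _ _); apply: leq_sum => x.
  rewrite inE => /andP [xA /existsP [y /andP [yA xy]]].
  by apply: (@edges_gt0 _ _ x y) => //; rewrite !inE.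
have ltU : #|U| < 3 by apply: leq_ltn_trans leU lt3.
have [b bA] : exists b, b \notin A.
  by apply/existsP; rewrite -negb_forall; apply: contra AT => /forallP h;
    apply/eqP/setP => x; rewrite h inE.
have [sAU | /subsetPn [a aA aU]] := boolP (A \subset U).
  have leA := leq_ltn_trans (subset_leq_card sAU) ltU.
  have gt0 : 0 < #|A| by apply/card_gt0P; exists a0.
  have eAA : edges A A <= #|A| * #|A|.-1.
    rewrite edges_sum -sum_nat_const; apply: leq_sum => x xA.
    by rewrite (leq_trans (edges1_self x A)) // (cardsD1 x A) xA.
  have := edges_split A A.
  by case: #|A| leA gt0 eAA => [|[|[|]]] //= _ _; lia.
have bU : b \notin U by rewrite inE (negbTE bA).
have /connectP := conn U ltU (Sub a aU) (Sub b bU).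
case=> p; rewrite -[a]/(val (Sub a aU : delete U)) in aA *.
move: (Sub a aU : delete U) aA => z zA pth eb.
have : val (last z p) \notin A by rewrite -eb.
elim: p z zA pth {eb} => [|w p IH] z zA /=; first by rewrite zA.
move=> /andP [zw]; apply: IH; apply/negPn/negP => wA.
have := valP z; rewrite /= inE zA /= => /existsP []; exists (val w).
by rewrite wA.
Qed.

(** A separating set [S] sends at least three edges to the component [A] and three to the rest [B].
    As [S] has degree sum at most 6, it consists of two nonadjacent vertices [s] and [t], with three
    edges to each side. If [s] has p neighbours in [A], the cuts around [s |: A] and [t |: A] have
    2(3 - p) and 2p edges, and one of these numbers is below 3. *)
Lemma cut3_three_connected : cut3 -> 3 < #|G| -> three_connected G.
Proof.
move=> c3 gt3; split=> // S ltS x y; apply/negPn/negP => nxy.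
pose A := [set val z | z in connect (@adj (delete S)) x].
pose B := ~: (A :|: S).
have AS : [disjoint A & S].
  rewrite -setI_eq0; apply/eqP/setP => z; rewrite !inE.
  by apply/negP => /andP [/imsetP [w _ ->]]; apply/negP/(valP w).
have AB : [disjoint A & B].
  by rewrite -setI_eq0 /B setCU setIA setICr set0I.
have BS : [disjoint B & S].
  by rewrite -setI_eq0 /B setCU -setIA (setIC (~: S)) setICr setI0.
have xA : val x \in A by apply/imsetP; exists x => //; apply: connect0.
have yB : val y \in B.
  rewrite !inE negb_or (valP y) andbT; apply: contra nxy.
  by case/imsetP => z xz /val_inj ->.
have eAB : edges A B = 0.
  apply: edges_eq0 => u v /imsetP [z xz ->] vB zv.
  move: vB; rewrite !inE negb_or => /andP [vA vS].
  case/negP: vA; apply/imsetP; exists (Sub v vS) => //.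
  by apply: connect_trans xz _; apply: connect1.
have cutE (C D : {set G}) : [disjoint C & D] -> C :|: D = setT -> ~: C = D.
  move=> dCD uCD; apply/setP => z; have := in_setT z; rewrite -uCD !inE.
  have /setP /(_ z) := disjoint_setI0 dCD; rewrite !inE.
  by case: (z \in C); case: (z \in D).
have ABS : A :|: S :|: B = setT by rewrite setUCr.
have cA : ~: A = S :|: B.
  apply: cutE; last by rewrite setUA.
  by rewrite disjoints_subset setCU subsetI -!disjoints_subset AS.
have cB : ~: B = A :|: S by rewrite setCK.
have nT (C : {set G}) z : z \notin C -> C != setT.
  by apply: contraNneq => ->; rewrite inE.
have n0 (C : {set G}) z : z \in C -> C != set0 by move=> zC; apply/set0Pn; exists z.
have SB : [disjoint S & B] by rewrite disjoint_sym.
have yA : val y \notin A by move: yB; rewrite !inE negb_or => /andP [].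
have xB : val x \notin B by rewrite !inE xA.
have := c3 A (n0 _ _ xA) (nT _ _ yA); rewrite cA edgesUr // eAB addn0 => leA.
have := c3 B (n0 _ _ yB) (nT _ _ xB); rewrite cB edgesUr // (edgesC B A) eAB => leB.
have := edges_setT S; rewrite -ABS !edgesUr ?cB //; last first.
  by rewrite -setI_eq0 setIUl setU_eq0 !setI_eq0 AB.
rewrite (edgesC S A) (edgesC S B) => eS.
have /eqP /cards2P [s [t [st eSst]]] : #|S| = 2 by clear -leA leB eS ltS; lia.
have dst : [disjoint [set s] & [set t]] by rewrite disjoints1 inE.
have sS : s \in S by rewrite eSst !inE eqxx.
have tS : t \in S by rewrite eSst !inE eqxx orbT.
have nAst z : z \in S -> z \notin A.
  by move=> zS; rewrite (disjointFl AS zS).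
have nBst z : z \in S -> z \notin B.
  by move=> zS; rewrite (disjointFl BS zS).
have cutA u v : u \in S -> v \in S -> S = [set u; v] -> u != v ->
  3 <= edges A [set v] + edges [set u] B + adj u v.
  move=> uS vS eSuv uv.
  have duv : [disjoint [set u] & [set v]] by rewrite disjoints1 inE.
  have eC : ~: (A :|: [set u]) = [set v] :|: B.
    apply: cutE; last by rewrite -ABS eSuv !setUA.
    rewrite -setI_eq0 !(setIUr, setIUl) !setU_eq0 !setI_eq0 AB duv /=.
    by rewrite !disjoints1 nBst // disjoint_sym disjoints1 nAst.
  have dAu : [disjoint A & [set u]] by rewrite disjoint_sym disjoints1 nAst.
  have dvB : [disjoint [set v] & B] by rewrite disjoints1 nBst.
  have nv : v \notin A :|: [set u] by rewrite !inE negb_or nAst // eq_sym.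
  have := c3 _ (n0 _ _ (introT setUP (or_introl xA))) (nT _ _ nv).
  by rewrite eC edgesUl // !edgesUr // eAB edges11 addn0 addnA addnAC.
have hs := cutA s t sS tS eSst st.
have ht := cutA t s tS sS (etrans eSst (setUC _ _)) (etrans (congr1 negb (eq_sym _ _)) st).
have eA : edges A S = edges A [set s] + edges A [set t].
  by rewrite eSst edgesUr.
have eB : edges B S = edges [set s] B + edges [set t] B.
  by rewrite eSst edgesUr // !(edgesC B).
have eSS : edges S S = 2 * adj s t.
  rewrite eSst edgesUl // !edgesUr // !edges11 !adj_irrefl (adj_sym t s).
  by rewrite add0n addn0 addnn mul2n.
have cS : #|S| = 2 by rewrite eSst cards2 st.
have := edges_setT [set s]; rewrite -ABS !edgesUr ?cB //; last first.
  by rewrite -setI_eq0 setIUl setU_eq0 !setI_eq0 AB.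
rewrite cards1 eSst edgesUr // !edges11 adj_irrefl (edgesC _ A).
move: leA leB eS hs ht; rewrite (adj_sym t s) add0n cS eA eB eSS.
clear; move: (edges _ _) (edges _ _) (edges _ _) (edges _ _) => p q r w.
by case: (adj _ _); lia.
Qed.

End EdgeCount.

(** * Independence of face boundaries *)

Section Orthogonality.
Import GRing.Theory.
Local Open Scope ring_scope.

(** The ranks of two matrices with orthogonal rows add up to at most the number of columns.
    Independence is spelled out on functions so that it can be checked combinatorially. *)
Lemma orthogonal_families_card (F : fieldType) (I J K : finType)
    (A : {set I}) (B : {set J}) (C : {set K}) (f : I -> K -> F) (g : J -> K -> F) :
  (forall u : I -> F, (forall k, k \in C -> \sum_(i in A) u i * f i k = 0) ->
    forall i, i \in A -> u i = 0) ->
  (forall u : J -> F, (forall k, k \in C -> \sum_(j in B) u j * g j k = 0) ->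
    forall j, j \in B -> u j = 0) ->
  (forall i j, i \in A -> j \in B -> \sum_(k in C) f i k * g j k = 0) ->
  (#|A| + #|B| <= #|C|)%N.
Proof.
move=> ff fg fg0.
have free (L : finType) (D : {set L}) (h : L -> K -> F) :
    (forall u : L -> F, (forall k, k \in C -> \sum_(i in D) u i * h i k = 0) ->
      forall i, i \in D -> u i = 0) ->
    row_free (\matrix_(i < #|D|, k < #|C|) h (enum_val i) (enum_val k)).
  move=> fh; apply: inj_row_free => v /rowP v0; apply/rowP => i; rewrite mxE.
  (* The coefficient vector, extended by 0 outside [D]. *)
  pose u x := \sum_(j < #|D| | enum_val j == x) v 0 j.
  have uE j : u (enum_val j) = v 0 j.
    by rewrite /u (big_pred1 j) // => l /=; rewrite (inj_eq enum_val_inj).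
  rewrite -uE; apply: fh (enum_valP i) => k kC.
  have := v0 (enum_rank_in kC k); rewrite !mxE => /(etrans _); apply.
  rewrite [LHS]big_enum_val /=; apply: eq_bigr => j _.
  by rewrite uE mxE enum_rankK_in.
have := mulmx0_rank_max (A := \matrix_(i < #|A|, k < #|C|) f (enum_val i) (enum_val k))
  (B := (\matrix_(i < #|B|, k < #|C|) g (enum_val i) (enum_val k))^T).
rewrite mxrank_tr (eqP (free _ _ _ ff)) (eqP (free _ _ _ fg)); apply.
apply/matrixP => i j; rewrite !mxE.
apply: etrans (fg0 _ _ (enum_valP i) (enum_valP j)); rewrite [RHS]big_enum_val /=.
by apply: eq_bigr => k _; rewrite !mxE.
Qed.

End Orthogonality.

(** * Darts, faces, and the bound on faces by the cycle space *)

Section Darts.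
Variable G : sgraph.
Implicit Types (A B : {set G}) (x y : G) (d : dart G).

Definition head d := tail (rev d).

Definition mkdart x y (xy : adj x y) : dart G :=
  exist (fun p : G * G => adj p.1 p.2) (x, y) xy.

Lemma adj_dart d : adj (tail d) (head d).
Proof. exact: (valP d). Qed.

Lemma dart_revK : involutive (@rev G).
Proof. by move=> d; apply: val_inj; case: d => [[]]. Qed.

Lemma dart_rev_inj : injective (@rev G).
Proof. exact: inv_inj dart_revK. Qed.

Lemma dart_inj d d' : tail d = tail d' -> head d = head d' -> d = d'.
Proof. by case: d d' => [[u v] uv] [[u' v'] uv'] /= e e'; apply/val_inj; congr (_, _). Qed.

Lemma head_rev d : head (rev d) = tail d.
Proof. by rewrite /head dart_revK. Qed.

Lemma rev_neq d : rev d != d.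
Proof.
apply/eqP => e; have := adj_dart d.
by rewrite /head e adj_irrefl.
Qed.

Lemma card_darts A B :
  #|[set d | (tail d \in A) && (head d \in B)]| = edges A B.
Proof.
rewrite -(card_imset _ val_inj) /edges pair_big /= -sum1_card.
rewrite big_mkcond [RHS]big_mkcond /=; apply: eq_bigr => [[x y] _] /=.
case: imsetP => [[[[u v] uv]]|nd].
  by rewrite inE => uvAB /= [-> ->]; move: uvAB; rewrite /head /tail /= uv => ->.
case: ifP => // h; case xy: (adj x y) => //.
by case: nd; exists (mkdart xy) => //; rewrite inE.
Qed.

Variable c : G -> bool.
Hypothesis hc : forall x y, adj x y -> c x != c y.

Lemma colour_rev d : c (tail (rev d)) = ~~ c (tail d).
Proof. by have := hc (adj_dart d); rewrite /head; do 2 case: (c _). Qed.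

(** The colouring orients the graph: exactly one of a dart and its reverse starts in the colour
    class [c]. *)
Lemma card_rev_closed (K : {set dart G}) :
  (forall d, d \in K -> rev d \in K) ->
  #|K| = 2 * #|[set d in K | c (tail d)]|.
Proof.
move=> hK; rewrite -(cardsID [set d | c (tail d)] K) mul2n -addnn.
have eI : K :&: [set d | c (tail d)] = [set d in K | c (tail d)].
  by apply/setP => d; rewrite !inE.
rewrite eI; congr addn; rewrite -(card_imset _ dart_rev_inj); apply: eq_card => d.
rewrite !inE; apply/imsetP/andP => [[d' ]|[dK cd]].
  by rewrite !inE => /andP [nc d'K] ->; rewrite hK // colour_rev nc.
by exists (rev d); rewrite ?dart_revK // !inE colour_rev cd hK.
Qed.

Hypothesis hcub : cubic G.
Hypothesis hcut : cut3 G.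
Variable rot : dart G -> dart G.
Hypothesis hrot : rotation rot.

Lemma rotation_inj : injective rot. Proof. by case: hrot. Qed.

Lemma tail_rot d : tail (rot d) = tail d.
Proof.
by apply/esym/eqP; rewrite -(proj2 hrot) fconnect1.
Qed.

Notation f := (face_step rot).

Lemma face_inj : injective f.
Proof. by move=> d d' /rotation_inj /dart_rev_inj. Qed.

Lemma tail_face d : tail (f d) = head d.
Proof. by rewrite tail_rot. Qed.

(** A face is named by the canonical dart of its orbit, so that sets of faces are sets of darts. *)
Definition face d := froot f d.

Lemma face_eq d d' : (face d == face d') = fconnect f d d'.
Proof. by rewrite (root_connect (fconnect_sym face_inj)). Qed.

Lemma face_step_face d : face (f d) = face d.
Proof. by apply/eqP; rewrite eq_sym face_eq fconnect1. Qed.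

Lemma faceK d : face (face d) = face d.
Proof. exact: (root_root (fconnect_sym face_inj)). Qed.

Lemma face_rot d : face (rot d) = face (rev d).
Proof. by rewrite -[rot d]/(rot (id d)) -{1}(dart_revK d) -[rot _]/(f _) face_step_face. Qed.

Definition faces : {set dart G} := [set face d | d in dart G].

Lemma face_in d : face d \in faces. Proof. exact: imset_f. Qed.

Lemma facesP r : r \in faces -> face r = r.
Proof. by case/imsetP => d _ ->; rewrite faceK. Qed.

Lemma card_faces : fcard f (dart G) = #|faces|.
Proof.
apply: eq_card => d; rewrite !inE andbT; apply/idP/idP => [/eqP <-|/facesP /eqP //].
exact: face_in.
Qed.

Import GRing.Theory.

(* The boundaries of all faces but one are linearly independent, lie in the
   cycle space and are thus orthogonal to the coboundaries of vertices. *)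
Lemma face_bound (K Phi : {set dart G}) (Y : {set G}) :
  (forall d, d \in K -> rev d \in K) ->
  Phi \subset faces ->
  (exists d, face d \notin Phi) ->
  (forall d, d \notin K -> face d \in Phi -> face d = face (rev d)) ->
  (forall A, (forall d, d \in K -> tail d \in A -> head d \in A) ->
    forall x y, x \in Y -> y \in Y -> x \in A -> y \in A) ->
  Y != set0 ->
  2 * (#|Phi| + #|Y|) <= #|K| + 2.
Proof.
move=> hK sPhi [d0 d0Phi] hPhi hY /set0Pn [y0 y0Y].
pose Kp := [set d in K | c (tail d)].
have -> : #|K| = 2 * #|Kp| by apply: card_rev_closed.
(* The coboundaries of all vertices of a graph sum to 0, so one vertex has to be left out for
   independence. *)
suff : #|Phi| + #|Y :\ y0| <= #|Kp| by rewrite (cardsD1 y0 Y) y0Y; lia.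
pose b (p q : bool) : rat := (p%:R - q%:R)%R.
apply: (orthogonal_families_card (F := rat)
  (f := fun r d => b (face d == r) (face (rev d) == r))
  (g := fun v d => b (tail d == v) (head d == v))).
- move=> u hu.
  (* [U] is the coefficient of the face at [d], read as 0 outside [Phi]. If the combination
     vanishes, [U] agrees across every edge, hence around every vertex, hence everywhere by
     connectedness; and it is 0 at [d0]. *)
  pose U d : rat := if face d \in Phi then u (face d) else 0%R.
  have UE d : (\sum_(r in Phi) u r * (face d == r)%:R)%R = U d.
    rewrite /U; case: ifP => dP.
      rewrite (bigD1 (face d)) //= eqxx mulr1 big1 ?addr0 // => r /andP [_].
      by rewrite eq_sym => /negbTE ->; rewrite mulr0.
    rewrite big1 // => r rP; case: eqP => [e|_]; last by rewrite mulr0.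
    by rewrite e rP in dP.
  have Urev d : U (rev d) = U d.
    wlog cd : d / c (tail d).
      move=> IH; case cd: (c (tail d)); first exact: IH.
      by rewrite -{2}(dart_revK d) -IH // colour_rev cd.
    case dK: (d \in K); last first.
      case: (boolP (face d \in Phi)) => [|nd].
        by move=> /hPhi; rewrite dK /U => /(_ isT) <-.
      case: (boolP (face (rev d) \in Phi)) => [|nrd].
        have rK : rev d \notin K.
          by apply: contraFN dK => /hK; rewrite dart_revK.
        by move=> /(hPhi _ rK); rewrite dart_revK /U => ->.
      by rewrite /U (negbTE nd) (negbTE nrd).
    have dKp : d \in Kp by rewrite inE dK.
    apply/eqP; rewrite eq_sym -subr_eq0; apply/eqP; rewrite -(hu d dKp).
    rewrite -!UE -sumrB; apply: eq_bigr => r _.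
    by rewrite /b mulrBr.
  have Urot d : U (rot d) = U d by rewrite -(Urev d) /U face_rot.
  have Uconn d d' : tail d = tail d' -> U d = U d'.
    move=> /eqP; rewrite -(proj2 hrot) => /iter_findex <-.
    by elim: (findex _ _ _) => //= n ->; rewrite Urot.
  pose A := [set x | [exists d, (tail d == x) && (U d != 0%R)]].
  have U0 d : U d = 0%R.
    apply/eqP; apply/negPn/negP => Ud.
    have dA : tail d \in A by rewrite inE; apply/existsP; exists d; rewrite eqxx.
    have Ud0 : tail d0 \notin A.
      rewrite inE; apply/negP => /existsP [d1 /andP [/eqP /Uconn ->]].
      by rewrite /U (negbTE d0Phi) eqxx.
    have : 3 <= edges A (~: A).
      apply: hcut; first by apply/set0Pn; exists (tail d).
      by apply: contraNneq Ud0 => ->; rewrite inE.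
    move=> /(leq_trans (ltn0Sn 2)) /edges_gt0P [x [y [xA]]].
    rewrite inE => yA xy; case/negP: yA.
    move: xA; rewrite !inE => /existsP [d1 /andP [/eqP e1 U1]].
    apply/existsP; exists (rev (mkdart xy)); rewrite Urev.
    by rewrite (@Uconn _ d1) ?U1 ?andbT // e1.
  move=> r rPhi; have := U0 r.
  by rewrite /U (facesP (subsetP sPhi _ rPhi)) rPhi.
- move=> w hw.
  (* A vanishing combination of coboundaries is a potential that is constant along [K]; on [Y] it
     equals its value at the omitted [y0], which is 0. *)
  pose W x : rat := if x \in Y :\ y0 then w x else 0%R.
  have WE x : (\sum_(v in Y :\ y0) w v * (x == v)%:R)%R = W x.
    rewrite /W; case: ifP => xP.
      rewrite (bigD1 x) //= eqxx mulr1 big1 ?addr0 // => r /andP [_].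
      by rewrite eq_sym => /negbTE ->; rewrite mulr0.
    rewrite big1 // => r rP; case: eqP => [e|_]; last by rewrite mulr0.
    by rewrite e rP in xP.
  have Whead d : d \in K -> W (tail d) = W (head d).
    have main d1 : d1 \in Kp -> W (tail d1) = W (head d1).
      move=> d1K; apply/eqP; rewrite -subr_eq0; apply/eqP; rewrite -(hw d1 d1K).
      by rewrite -!WE -sumrB; apply: eq_bigr => v _; rewrite /b mulrBr.
    move=> dK; case cd: (c (tail d)); first by apply: main; rewrite inE dK.
    rewrite -[tail d]head_rev; apply/esym/main.
    by rewrite inE hK // colour_rev cd.
  move=> y yY; have yY' : y \in Y by move: yY; rewrite inE => /andP [].
  have W0 : W y0 = 0%R by rewrite /W !inE eqxx.
  have Wcl d : d \in K -> tail d \in [set x | W x == 0%R] -> head d \in [set x | W x == 0%R].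
    by move=> dK; rewrite !inE Whead.
  have := hY _ Wcl y0 y y0Y yY'.
  by rewrite !inE W0 eqxx => /(_ isT) /eqP; rewrite /W yY.
- move=> r v rPhi vY.
  (* Each product splits into a term for [d] and one for [rev d], which turns the sum over one dart
     per edge into a sum over all darts. That sum telescopes along the face [r]: shifting by
     [face_step] exchanges heads and tails. *)
  pose h d : rat := ((face d == r)%:R * b (tail d == v) (head d == v))%R.
  have step1 : (\sum_(d in Kp) b (face d == r) (face (rev d) == r) *
      b (tail d == v) (head d == v))%R = (\sum_(d | c (tail d)) (h d + h (rev d)))%R.
    rewrite [LHS]big_mkcond [RHS]big_mkcond /=; apply: eq_bigr => d _.
    rewrite inE andbC; case: (c (tail d)) => //=.
    have -> : (h d + h (rev d) = b (face d == r) (face (rev d) == r) *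
      b (tail d == v) (head d == v))%R.
      by rewrite /h head_rev -/(head d) /b mulrBl -(opprB (tail d == v)%:R%R) mulrN.
    case: ifP => // dK.
    have -> : (face d == r) = (face (rev d) == r).
      apply/eqP/eqP => e; first by rewrite -e; apply/esym/hPhi; rewrite ?dK ?e.
      have rK : rev d \notin K by apply: contraFN dK => /hK; rewrite dart_revK.
      by rewrite -(dart_revK d) -hPhi ?e.
    by rewrite /b subrr mul0r.
  rewrite step1 big_split /=.
  have -> : (\sum_(d | c (tail d)) h (rev d) = \sum_(d | ~~ c (tail d)) h d)%R.
    rewrite (reindex_inj dart_rev_inj) /=; apply: eq_big => d; rewrite ?dart_revK //.
    by rewrite colour_rev.
  transitivity (\sum_d h d)%R; first by rewrite [RHS](bigID (fun d => c (tail d))).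
  rewrite /h /b.
  under eq_bigr => d _ do rewrite mulrBr.
  rewrite sumrB (reindex_inj face_inj) /=; apply/eqP; rewrite subr_eq0; apply/eqP.
  by apply: eq_bigr => d _; rewrite face_step_face tail_face.
Qed.

End Darts.

(** * Euler's formula for cubic maps *)

Section CubicMap.
Variable G : sgraph.
Implicit Types (A B X : {set G}) (x y : G) (d : dart G).

Hypothesis hcub : cubic G.
Hypothesis hcut : cut3 G.
Variable rot : dart G -> dart G.
Hypothesis hrot : rotation rot.

Notation f := (face_step rot).
Notation faces := (faces rot).

Lemma order_rot d : order rot d = 3.
Proof.
rewrite /order; transitivity (edges [set tail d] setT); last first.
  by rewrite edges_setT // cards1.
rewrite -card_darts; apply: eq_card => d'.
by rewrite !inE andbT eq_sym -(proj2 hrot).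
Qed.

Lemma rot3 d : rot (rot (rot d)) = d.
Proof. by have := iter_order (rotation_inj hrot) d; rewrite order_rot. Qed.

Lemma rot_neq d : rot d != d.
Proof.
have := orbit_uniq rot d; rewrite /orbit order_rot /= inE negb_or eq_sym.
by case/andP => /andP [].
Qed.

Lemma same_tail d d' : tail d' = tail d -> [\/ d' = d, d' = rot d | d' = rot (rot d)].
Proof.
move=> /esym/eqP; rewrite -(proj2 hrot) fconnect_orbit /orbit order_rot /= !inE.
by case/or3P => /eqP ->; [apply: Or31 | apply: Or32 | apply: Or33].
Qed.

(** Otherwise [f d] and [rev d] would be parallel, hence equal, against [rot_neq]. *)
Lemma face2_neq d : f (f d) != d.
Proof.
apply/eqP => e; have /eqP := rot_neq (rev d); apply.
rewrite -[rot _]/(f d); apply: dart_inj; first by rewrite tail_face.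
by rewrite head_rev -(tail_face hrot (f d)) e.
Qed.

Lemma card_dart : #|dart G| = 3 * #|G|.
Proof.
rewrite -[#|G|]cardsT -edges_setT // -card_darts.
by apply: eq_card => d; rewrite !inE.
Qed.

Lemma card_rot_orbits : fcard rot (dart G) = #|G|.
Proof.
apply/eqP; rewrite -(eqn_pmul2r (isT : 0 < 3)) (fcard_order_set (rotation_inj hrot)) //.
- by rewrite card_dart mulnC.
- by apply/subsetP => d _; rewrite inE order_rot.
Qed.

Lemma card_rev_orbits : 2 * fcard (@rev G) (dart G) = 3 * #|G|.
Proof.
rewrite mulnC (fcard_order_set (@dart_rev_inj G)) ?card_dart //.
apply/subsetP => d _; rewrite inE; apply/eqP.
apply: (order_cycle (p := [:: d; rev d])); rewrite ?inE ?eqxx //=.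
  by rewrite dart_revK !eqxx.
by rewrite inE eq_sym rev_neq.
Qed.

Lemma dart_link_sym : connect_sym (dart_link rot).
Proof.
have sub d d' : connect (dart_link rot) d d' -> connect (dart_link rot) d' d.
  move=> /connectP [p + ->]; elim: p d => [|d1 p IH] d /=; first by rewrite connect0.
  move=> /andP [dd1 /IH h]; apply: connect_trans h _.
  case/orP: dd1 => /eqP <-.
    by apply: connect1; rewrite /dart_link dart_revK eqxx.
  have cr d2 : connect (dart_link rot) d2 (rot d2).
    by apply: connect1; rewrite /dart_link eqxx orbT.
  by rewrite -{2}(rot3 d); apply: connect_trans (cr _) (cr _).
by move=> d d'; apply/idP/idP; apply: sub.
Qed.

Lemma dart_link_connect d d' : connect (dart_link rot) d d'.
Proof.
have cr d1 d2 : tail d1 = tail d2 -> connect (dart_link rot) d1 d2.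
  move=> /eqP; rewrite -(proj2 hrot); apply: connect_sub => d3 d4 /= /eqP <-.
  by apply: connect1; rewrite /dart_link eqxx orbT.
pose A := [set tail d1 | d1 in connect (dart_link rot) d].
suff /imsetP [d1 dd1 e] : tail d' \in A.
  by apply: connect_trans dd1 (cr _ _ _).
apply/negPn/negP => nA.
have : 3 <= edges A (~: A).
  apply: hcut; first by apply/set0Pn; exists (tail d); apply: imset_f; apply: connect0.
  by apply: contraNneq nA => ->; rewrite inE.
move=> /(leq_trans (ltn0Sn 2)) /edges_gt0P [x [y [/imsetP [d1 dd1 ->]]]].
rewrite inE => yA xy; case/negP: yA; apply/imsetP.
exists (rev (mkdart xy)) => //; apply: connect_trans dd1 _.
apply: (connect_trans (y := mkdart xy)); first exact: cr.
by apply: connect1; rewrite /dart_link eqxx.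
Qed.

Lemma card_components d : n_comp (dart_link rot) (dart G) = 1.
Proof.
rewrite -(n_comp_connect dart_link_sym d); apply: eq_n_comp_r => d'.
by rewrite !inE dart_link_connect.
Qed.

(** Edges and components are determined: 3V/2 of the former and one of the latter. The vertex [x]
    excludes the empty graph, which has no component. *)
Lemma euler_sphereE x : euler_sphere rot <-> 2 * #|faces| = #|G| + 4.
Proof.
have [y xy] : exists y, adj x y.
  have : 0 < #|[set y | adj x y]| by rewrite hcub.
  by case/card_gt0P => y; rewrite inE; exists y.
rewrite /euler_sphere card_faces // card_rot_orbits card_dart.
have := card_rev_orbits; rewrite (card_components (mkdart xy)).
by move: (fcard _ _) => r; split; lia.
Qed.

End CubicMap.

(** * Faces inside one side of a cut *)

Section PlanarMap.
Variable G : sgraph.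
Implicit Types (A B X : {set G}) (x y : G) (d : dart G).

Variable c : G -> bool.
Hypothesis hc : forall x y, adj x y -> c x != c y.
Hypothesis hcub : cubic G.
Hypothesis hcut : cut3 G.
Variable rot : dart G -> dart G.
Hypothesis hrot : rotation rot.

Notation f := (face_step rot).
Notation face := (face rot).
Notation faces := (faces rot).

Let finj := face_inj hrot.

Lemma cut_ge3 A x y : x \in A -> y \notin A -> 3 <= edges A (~: A).
Proof.
move=> xA yA; apply: hcut; first by apply/set0Pn; exists x.
by apply: contraNneq yA => ->; rewrite inE.
Qed.

(** The genus is nonnegative: this is [face_bound] for the whole graph and all faces but one. *)
Lemma card_faces_le x : 2 * #|faces| <= #|G| + 4.
Proof.
have [y xy] : exists y, adj x y.
  have : 0 < #|[set y | adj x y]| by rewrite hcub.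
  by case/card_gt0P => y; rewrite inE; exists y.
pose d0 := mkdart xy.
have := @face_bound _ _ hc hcut _ hrot setT (faces :\ face d0) setT.
rewrite !cardsT (card_dart hcub).
have -> : #|faces| = #|faces :\ face d0|.+1 by rewrite (cardsD1 (face d0)) face_in.
move=> h; suff : 2 * (#|faces :\ face d0| + #|G|) <= 3 * #|G| + 2 by lia.
apply: h => //.
- by apply: subD1set.
- by exists d0; rewrite !inE eqxx.
- by move=> d; rewrite inE.
- move=> A hA u v _ _ uA; apply/negPn/negP => vA.
  have /(leq_trans (ltn0Sn 2)) /edges_gt0P [p [q [pA qA pq]]] := cut_ge3 uA vA.
  by have := hA (mkdart pq) (in_setT _) pA; move: qA; rewrite inE => /negP.
by apply/set0Pn; exists x; rewrite inE.
Qed.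

Lemma euler_of_faces x : #|G| + 4 <= 2 * #|faces| -> euler_sphere rot.
Proof.
move=> h; apply/(euler_sphereE hcub hcut hrot x)/eqP.
by rewrite eqn_leq card_faces_le.
Qed.

Hypothesis heul : euler_sphere rot.

Lemma euler_faces x : 2 * #|faces| = #|G| + 4.
Proof. exact/(euler_sphereE hcub hcut hrot x). Qed.

(** An edge with the same face on both sides cancels from all boundaries, so [face_bound] would
    apply without it. The graph stays connected, and the inequality would improve by 2, against
    Euler's formula. *)
Lemma face_rev_neq d0 : face d0 != face (rev d0).
Proof.
apply/eqP => e0.
have := @face_bound _ _ hc hcut _ hrot (~: [set d0; rev d0]) (faces :\ face d0) setT.
have := euler_faces (tail d0); have := cardsC [set d0; rev d0].
rewrite cardsT card_dart // cards2 eq_sym rev_neq.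
have -> : #|faces| = #|faces :\ face d0|.+1 by rewrite (cardsD1 (face d0)) face_in.
move=> e1 e2 h; suff : 2 * (#|faces :\ face d0| + #|G|) <= #|~: [set d0; rev d0]| + 2 by lia.
apply: h => {e1 e2} //.
- by move=> d; rewrite !inE !(inv_eq (@dart_revK G)) dart_revK orbC.
- by apply: subD1set.
- by exists d0; rewrite !inE eqxx.
- by move=> d; rewrite !inE negbK => /orP [] /eqP ->; rewrite ?dart_revK.
- move=> A hA u v _ _ uA; apply/negPn/negP => vA.
  have := cut_ge3 uA vA; rewrite -card_darts ltnNge; apply/negP/negPn.
  have : #|[set d0; rev d0]| <= 2 by rewrite cards2; case: (_ != _).
  apply: leq_trans; apply/subset_leq_card/subsetP => d; rewrite inE => /andP [dA].
  by rewrite in_setC => hd; apply: contraNT hd => dK; apply: hA; rewrite ?in_setC.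
by apply/set0Pn; exists (tail d0); rewrite inE.
Qed.

Definition inner X : {set dart G} :=
  [set r in faces | [forall d, (face d == r) ==> (tail d \in X)]].

Lemma innerP X d :
  reflect (forall d', face d' = face d -> tail d' \in X) (face d \in inner X).
Proof.
rewrite inE face_in; apply: (iffP forallP) => h d'.
  by move=> e; move: (h d'); rewrite e eqxx.
by apply/implyP => /eqP; apply: h.
Qed.

Lemma tail_inner X d : face d \in inner X -> tail d \in X.
Proof. by move/innerP; apply. Qed.

Lemma head_inner X d : face d \in inner X -> head d \in X.
Proof. by move/innerP => h; rewrite -(tail_face hrot); apply: h; rewrite face_step_face. Qed.

(** [face_bound] for the darts inside [X], of which there are [3 * #|X| - 3]. *)
Lemma inner_bound X x y : x \in X -> y \notin X -> edges X (~: X) = 3 ->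
  2 * #|inner X| < #|X|.
Proof.
move=> xX yX cX.
have := @face_bound _ _ hc hcut _ hrot [set d | (tail d \in X) && (head d \in X)] (inner X) X.
rewrite card_darts; have := edges_split hcub X X; rewrite cX => eX h.
suff : 2 * (#|inner X| + #|X|) <= edges X X + 2 by lia.
apply: h => {eX}.
- by move=> d; rewrite !inE head_rev andbC.
- by apply/subsetP => r; rewrite inE => /andP [].
- have [z yz] : exists z, adj y z.
    have : 0 < #|[set z | adj y z]| by rewrite hcub.
    by case/card_gt0P => z; rewrite inE; exists z.
  by exists (mkdart yz); apply: contra yX => /tail_inner.
- by move=> d; rewrite inE => nd dX; rewrite (tail_inner dX) (head_inner dX) in nd.
(* [X] is connected: two parts without edges between them would each need three of the three cut
   edges. *)
- move=> A hA u v uX vX uA; apply/negPn/negP => vA.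
  have e0 : edges (X :&: A) (X :\: A) = 0.
    apply: edges_eq0 => p q; rewrite !inE => /andP [pX pA] /andP [qA qX] pq.
    by have := hA (mkdart pq); rewrite inE /= => /(_ (introT andP (conj pX qX)) pA); apply/negP.
  have uXA : u \in X :&: A by rewrite inE uX.
  have vXA : v \in X :\: A by rewrite inE vA.
  have yu : y \notin X :&: A by rewrite inE (negbTE yX).
  have yv : y \notin X :\: A by rewrite inE (negbTE yX) andbF.
  have := cut_ge3 uXA yu; have := cut_ge3 vXA yv.
  have -> : ~: (X :&: A) = (X :\: A) :|: ~: X.
    by apply/setP => z; rewrite !inE; do 2 case: (z \in _).
  have -> : ~: (X :\: A) = (X :&: A) :|: ~: X.
    by apply/setP => z; rewrite !inE; do 2 case: (z \in _).
  have dX (Z : {set G}) : Z \subset X -> [disjoint Z & ~: X].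
    by rewrite disjoints_subset setCK.
  rewrite !edgesUr ?dX ?subsetIl ?subsetDl // (edgesC (X :\: A) (X :&: A)) e0.
  by move: cX; rewrite (edgesID A X (~: X)); clear; lia.
by apply/set0Pn; exists x.
Qed.

Definition out X : {set dart G} := [set d | (tail d \in X) && (head d \notin X)].

Lemma card_out X : #|out X| = edges X (~: X).
Proof. by rewrite -card_darts; apply: eq_card => d; rewrite !inE. Qed.

(** Such a face has darts starting on both sides; following it from one that starts in [X], some
    step has to leave [X]. *)
Lemma crossing_face X d : face d \notin inner X -> face d \notin inner (~: X) ->
  face d \in [set face d' | d' in out X].
Proof.
move=> n1 n2; apply/negPn/negP => n3.
have /existsP [d1 /andP [/eqP e1 t1]] : [exists d1, (face d1 == face d) && (tail d1 \in X)].
  apply: contraNT n2; rewrite negb_exists => /forallP h.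
  by apply/innerP => d' /eqP e'; have := h d'; rewrite e' inE.
have /existsP [d2 /andP [/eqP e2 t2]] : [exists d2, (face d2 == face d) && (tail d2 \notin X)].
  apply: contraNT n1; rewrite negb_exists => /forallP h.
  by apply/innerP => d' /eqP e'; have := h d'; rewrite e' negbK.
have : fconnect f d1 d2 by rewrite -face_eq // e1 e2.
move=> /iter_findex e; move: t2; rewrite -e; apply/negP/negPn.
elim: (findex _ _ _) => //= n tn; rewrite tail_face //; apply/negPn/negP => hn.
case/negP: n3; apply/imsetP; exists (iter n f d1); first by rewrite inE tn.
by rewrite -e1; elim: n {tn hn} => //= n ->; rewrite face_step_face.
Qed.

Lemma face_count X : #|faces| <= #|inner X| + #|inner (~: X)| + #|[set face d | d in out X]|.
Proof.
apply: (@leq_trans #|inner X :|: inner (~: X) :|: [set face d | d in out X]|); last first.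
  by rewrite (leq_trans (leq_card_setU _ _)) // leq_add2r leq_card_setU.
apply/subset_leq_card/subsetP => r /imsetP [d _ ->].
rewrite [face d \in _]inE [face d \in _ :|: _]inE.
have [//|n1] := boolP (face d \in inner X).
have [//|n2] := boolP (face d \in inner (~: X)).
exact: crossing_face.
Qed.

(** * Equality in the face count of a 3-edge-cut *)

Section Cut.
Variables (X : {set G}) (x y : G).
Hypotheses (xX : x \in X) (yX : y \notin X) (cX : edges X (~: X) = 3).

Lemma cutC : edges (~: X) (~: ~: X) = 3.
Proof. by rewrite setCK edgesC. Qed.

(** Twice the three upper bounds is [(#|X| - 1) + (#|~: X| - 1) + 6 = #|G| + 4], which is twice the
    number of faces; so none of the bounds is strict. *)
Lemma inner_out_card :
  2 * #|inner X| + 1 = #|X| /\ #|[set face d | d in out X]| = 3.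
Proof.
have b1 := inner_bound xX yX cX.
have yX' : y \in ~: X by rewrite inE.
have xX' : x \notin ~: X by rewrite inE xX.
have b2 := inner_bound yX' xX' cutC.
have e := euler_faces x; have fc := face_count X.
have b3 : #|[set face d | d in out X]| <= 3 by rewrite -cX -card_out leq_imset_card.
by have := cardsC X; move: b1 b2 e fc b3; clear; lia.
Qed.

Lemma face_out_inj : {in out X &, injective face}.
Proof. by apply/imset_injP; rewrite card_out cX; case: inner_out_card => _ ->. Qed.

(** [X] contains exactly [6 * #|inner X|] darts, and at least one of them lies on a face crossing
    the cut. The inner faces are therefore shorter than 6 on average. *)
Lemma small_face : 1 < #|X| -> exists d,
  face d \in inner X /\ order f d < 6.
Proof.
move=> gt1; pose K := [set d | (tail d \in X) && (head d \in X)].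
have [d0 [d0K d0n]] : exists d, d \in K /\ face d \notin inner X.
  have /card_gt0P [d] : 0 < #|out X| by rewrite card_out cX.
  rewrite inE => /andP [tX hX].
  have fout d' : d' \in out X -> face d' \notin inner X /\ face (rev d') \notin inner X.
    rewrite inE => /andP [t1 h1]; split; first by apply: contra h1 => /head_inner.
    by apply: contra h1 => /tail_inner.
  have dout : d \in out X by rewrite inE tX.
  case r1 : (head (rot d) \in X).
    by exists (rot d); rewrite inE tail_rot // tX r1 face_rot //; case: (fout d dout).
  have rout : rot d \in out X by rewrite inE tail_rot // tX r1.
  case r2 : (head (rot (rot d)) \in X).
    by exists (rot (rot d)); rewrite inE !tail_rot // tX r2 face_rot //; case: (fout _ rout).
  have all_out d' : tail d' = tail d -> head d' \notin X.
    by case/(same_tail hcub hrot) => ->; rewrite ?hX ?r1 ?r2.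
  (* Here all three edges at [tail d] leave [X]; they exhaust the cut, so nothing connects the rest
     of [X] to the graph. *)
  have [z] : exists z, z \in X :\ tail d.
    by apply/card_gt0P; move: gt1; rewrite (cardsD1 (tail d)) tX.
  rewrite !inE => /andP [zt zX].
  have t1 : tail d \in [set tail d] by rewrite inE.
  have z1 : z \notin [set tail d] by rewrite inE.
  have e0 : edges [set tail d] (X :\ tail d) = 0.
    apply: edges_eq0 => p q; rewrite !inE => /eqP -> /andP [_ qX] pq.
    by have := all_out (mkdart pq) erefl; rewrite qX.
  have c1 := cut_ge3 t1 z1.
  have z2 : z \in X :\ tail d by rewrite !inE zt.
  have t2 : tail d \notin X :\ tail d by rewrite !inE eqxx.
  have c2 := cut_ge3 z2 t2.
  have eX : edges X (~: X) = edges [set tail d] (~: X) + edges (X :\ tail d) (~: X).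
    rewrite (edgesID [set tail d]) (setIidPr _) ?sub1set //.
  move: c1 c2 cX; rewrite eX.
  have -> : ~: [set tail d] = X :\ tail d :|: ~: X.
    by apply/setP => w; rewrite !inE; case: eqP => [->|_]; rewrite ?tX /= ?orbN.
  have -> : ~: (X :\ tail d) = [set tail d] :|: ~: X.
    by apply/setP => w; rewrite !inE negb_and negbK.
  rewrite !edgesUr ?(edgesC _ [set tail d]) ?e0 ?disjoints1 ?inE ?tX //; last first.
    by rewrite disjoints_subset setCK subD1set.
  by rewrite (edgesC _ (~: X)) (edgesC (X :\ _) (~: X)); clear; lia.
case: inner_out_card => eI _.
pose D := [set d | face d \in inner X].
have DK : #|D| < #|K|.
  apply/proper_card/properP; split; last by exists d0; rewrite // inE.
  by apply/subsetP => d; rewrite [d \in D]inE [d \in K]inE => dX; rewrite (tail_inner dX) (head_inner dX).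
have eK := edges_split hcub X X; rewrite cX -card_darts -/K in eK.
suff /existsP [d /andP [dX lt6]] : [exists d, (face d \in inner X) && (order f d < 6)] by exists d.
apply: contraLR DK; rewrite negb_exists => /forallP hall.
rewrite -leqNgt; apply: (@leq_trans (6 * #|inner X|)); first by move: eI eK; clear; lia.
rewrite -[#|D|]sum1_card (partition_big face (mem (inner X))) /=; last first.
  by move=> d; rewrite inE.
rewrite mulnC -sum_nat_const; apply: leq_sum => r rX.
have er : face r = r by move: rX; rewrite inE => /andP [/facesP ->].
have := hall r; rewrite er rX /= -leqNgt => h; apply: leq_trans h _.
rewrite sum1_card; apply/subset_leq_card/subsetP => d.
move=> rd; have : face r == face d by rewrite face_eq.
by rewrite er unfold_in => /eqP {}rd; rewrite inE -rd rX /= eqxx.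
Qed.

(** Every step changes the colour, which excludes the lengths 1, 3 and 5; length 2 is excluded by
    [face2_neq]. *)
Lemma four_face : 1 < #|X| -> exists d,
  [/\ iter 4 f d = d & forall n, tail (iter n f d) \in X].
Proof.
move=> /small_face [d [dX lt6]]; exists d; split; last first.
  move=> n; apply: tail_inner; move/innerP: dX => dX.
  apply/innerP => d1 e; apply: dX; rewrite e; elim: n {e} => //= n <-;
  by rewrite face_step_face.
have cf d1 : c (tail (f d1)) = ~~ c (tail d1).
  by rewrite tail_face // colour_rev.
have := iter_order finj d; have := order_gt0 f d; have := face2_neq hcub hrot d.
case: (order f d) lt6 => [|[|[|[|[|[|]]]]]] //=.
- by move=> _ _ _ /(congr1 (fun d => c (tail d))); rewrite cf; case: (c _).
- by move=> _ /eqP.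
- by move=> _ _ _ /(congr1 (fun d => c (tail d))); rewrite !cf; case: (c _).
- by move=> _ _ _ /(congr1 (fun d => c (tail d))); rewrite !cf; case: (c _).
Qed.

End Cut.
End PlanarMap.

(** * Planarity from an abstract map *)

(* The set A with n, e plays the part of the darts of G. The function k, constant
   on faces, bounds their number from below; [card_faces_le] is the other half of
   Euler's formula. *)
Lemma planar_of_map (G : sgraph) (c : G -> bool) (x0 : G) (D U : finType)
    (A : {set D}) (n e : D -> D) (t : D -> G) (k : D -> U) :
  (forall x y, adj x y -> c x != c y) -> cubic G -> cut3 G ->
  (forall d, d \in A -> n d \in A) ->
  (forall d, d \in A -> e d \in A) ->
  {in A &, injective n} ->
  (forall d, d \in A -> t (n d) = t d) ->
  {in A &, forall d d', t d = t d' -> fconnect n d d'} ->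
  {in A, involutive e} ->
  (forall d, d \in A -> adj (t d) (t (e d))) ->
  {in A &, forall d d', t d = t d' -> t (e d) = t (e d') -> d = d'} ->
  #|A| = 3 * #|G| ->
  (forall d, d \in A -> k (n (e d)) = k d) ->
  #|G| + 4 <= 2 * #|k @: A| ->
  planar G.
Proof.
move=> hc hcub hcut nA eA n_inj tn t_conn eK te t_inj cA kf ck.
pose h d := (t d, t (e d)).
have h_inj : {in A &, injective h}.
  by move=> d d' dA d'A [e1 e2]; apply: t_inj.
(* Injectivity and the cardinality [3 * #|G|] already force every dart of [G] to come from [A]. *)
have h_surj : h @: A = [set p : G * G | adj p.1 p.2].
  apply/eqP; rewrite eqEcard; apply/andP; split.
    by apply/subsetP => p /imsetP [d dA ->]; rewrite inE te.
  rewrite card_in_imset // cA -(card_dart hcub) -cardsT -(card_imset _ val_inj).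
  apply/subset_leq_card/subsetP => p; rewrite inE => pa.
  by apply/imsetP; exists (mkdart pa); rewrite ?inE //; case: p pa.
have ex (p : dart G) : exists d, (d \in A) && (h d == val p).
  have : val p \in h @: A by rewrite h_surj inE (valP p).
  by case/imsetP => d dA ->; exists d; rewrite dA eqxx.
pose g p := xchoose (ex p).
have gA p : g p \in A by have /andP [] := xchooseP (ex p).
have hg p : h (g p) = val p by have /andP [_ /eqP] := xchooseP (ex p).
have gE d p : d \in A -> h d = val p -> g p = d.
  by move=> dA e1; apply: h_inj => //; rewrite hg.
have g_inj : injective g.
  by move=> p q e1; apply: val_inj; rewrite -!hg e1.
(* The default [p] is never taken, since [h] maps [A] to pairs of adjacent vertices. *)
pose rot (p : dart G) : dart G := insubd p (h (n (g p))).
have g_rot p : g (rot p) = n (g p).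
  by apply: gE; rewrite ?nA // val_insubd /h te ?nA.
have g_rev p : g (rev p) = e (g p).
  apply: gE; rewrite ?eA // /h eK //.
  by have := hg p; case: p => [[u v] uv] [e1 e2]; congr (_, _).
have t_g p : t (g p) = tail p by have := hg p; rewrite /tail => <-.
have hrot : rotation rot.
  split=> [p q e1|p q].
    by apply/g_inj/n_inj => //; rewrite -!g_rot e1.
  apply/idP/eqP => [/iter_findex <-|].
    by elim: (findex _ _ _) => //= m ->; rewrite -!t_g g_rot tn.
  rewrite -!t_g => /(t_conn _ _ (gA p) (gA q)) /iter_findex e1.
  suff -> : q = iter (findex n (g p) (g q)) rot p by apply: fconnect_iter.
  apply: g_inj; rewrite -{1}e1; elim: (findex _ _ _) => //= m ->.
  by rewrite g_rot.
exists rot; split=> //; apply: (euler_of_faces hc hcub hcut hrot x0).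
apply: leq_trans ck _; rewrite leq_pmul2l //.
apply: leq_trans (leq_imset_card (k \o g) (faces rot)).
apply/subset_leq_card/subsetP => u /imsetP [d dA ->].
pose p := mkdart (te d dA); have gp : g p = d by apply: gE.
apply/imsetP; exists (face rot p); first exact: face_in.
rewrite /= -gp; have /iter_findex <- : fconnect (face_step rot) p (face rot p).
  exact: connect_root.
elim: (findex _ _ _) => //= m ->; rewrite /face_step g_rot g_rev.
by rewrite kf.
Qed.

(** * Contraction of one side of a 3-edge-cut *)

Lemma big_option_nat (T : finType) (F : option T -> nat) :
  \sum_y F y = F None + \sum_v F (Some v).
Proof.
rewrite (bigD1 None) //=; congr addn.
rewrite (reindex_omap Some id) /=; last by case.
by apply: eq_bigl => v; rewrite eqxx.
Qed.

Section Contraction.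
Variable G : sgraph.
Implicit Types (A B X : {set G}) (x y : G) (d : dart G).

Variable c : G -> bool.
Hypothesis hc : forall x y, adj x y -> c x != c y.
Hypothesis hcub : cubic G.
Hypothesis hcut : cut3 G.
Variable rot : dart G -> dart G.
Hypothesis hrot : rotation rot.
Hypothesis heul : euler_sphere rot.

Variables (S N : {set G}) (b : bool).
Hypothesis cS : edges S (~: S) = 3.
Hypothesis gt1 : 1 < #|~: S|.
Hypothesis hN : forall u, u \notin S -> (u \in N) = [exists x in S, adj x u].
Hypothesis cout : forall x y, x \in S -> y \notin S -> adj x y -> c x = b.

Notation T := (delete S).
Notation face := (face rot).

Lemma add_vertex_sym : symmetric (@add_vertex G S N).
Proof. by move=> [u|] [v|] //=; rewrite /del_adj adj_sym. Qed.

Lemma add_vertex_irrefl : irreflexive (@add_vertex G S N).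
Proof. by move=> [u|] //=; rewrite /del_adj adj_irrefl. Qed.

Definition contraction : sgraph := SGraph add_vertex_sym add_vertex_irrefl.

(** Two edges from [u] to [S] would leave at most two edges around [u |: S], which is proper by
    [gt1]. Hence contracting [S] creates no parallel edges. *)
Lemma edges_to_le1 u : u \notin S -> edges [set u] S <= 1.
Proof.
move=> uS; rewrite leqNgt; apply/negP => gt.
have [w] : exists w, w \in ~: S :\ u.
  by apply/card_gt0P; move: gt1; rewrite (cardsD1 u (~: S)) inE uS.
rewrite !inE => /andP [wu wS].
have wn : w \notin u |: S by rewrite !inE negb_or wu.
have := cut_ge3 hcut (setU11 u S) wn.
have dS : [disjoint [set u] & S] by rewrite disjoints1.
have eC : ~: S = u |: ~: (u |: S).
  by apply/setP => z; rewrite !inE; case: eqP => [->|_].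
have dC : [disjoint [set u] & ~: (u |: S)] by rewrite disjoints1 !inE eqxx.
have := edges_split hcub [set u] S; move: cS; rewrite eC !edgesUr // !edgesUl //.
rewrite edges11 adj_irrefl cards1 (edgesC S [set u]).
by move: gt; clear; lia.
Qed.

Lemma mem_N u : u \notin S -> (u \in N : nat) = edges [set u] S.
Proof.
move=> uS; rewrite hN //; case: existsP => [[x /andP [xS xu]]|n].
  apply/eqP; rewrite eqn_leq edges_to_le1 // andbT.
  by apply: (edges_gt0 (x := u) (y := x)); rewrite ?inE // adj_sym.
apply/esym/edges_eq0 => p q; rewrite inE => /eqP -> qS uq.
by case: n; exists q; rewrite qS adj_sym.
Qed.

Lemma edges_contraction (u : T) (B : {set contraction}) :
  edges [set (Some u : contraction)] B =
  edges [set val u] (val @: [set v : T | Some v \in B]) + (None \in B) * edges [set val u] S.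
Proof.
rewrite /edges !big_set1 big_mkcond big_option_nat addnC; congr addn.
  rewrite big_imset; last by move=> ? ? _ _; apply: val_inj.
  by rewrite [RHS]big_mkcond; apply: eq_bigr => v _; rewrite inE.
have <- : (val u \in N : nat) = \sum_(y in S) adj (val u) y.
  by rewrite (mem_N (valP u)) /edges big_set1.
by case: (_ \in B); rewrite ?mul0n ?mul1n.
Qed.

Lemma cubic_contraction : cubic contraction.
Proof.
move=> x; transitivity (edges [set x] setT).
  by rewrite edges1_card; apply: eq_card => y; rewrite !inE.
have eT : val @: [set v : T | Some v \in [set: contraction]] = ~: S.
  apply/setP => z; rewrite inE; apply/imsetP/idP => [[v _ ->]|zS].
    exact: valP v.
  by exists (Sub z zS); rewrite ?inE.
case: x => [u|].
  rewrite edges_contraction eT inE mul1n addnC (edges_split hcub).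
  by rewrite cards1.
rewrite /edges big_set1 (eq_bigl predT) => [|y]; last by rewrite !inE.
rewrite big_option_nat add0n -cS edgesC edges_sum -eT.
rewrite big_imset; last by move=> ? ? _ _; apply: val_inj.
rewrite [RHS](eq_bigl predT) => [|v]; last by rewrite !inE.
by apply: eq_bigr => v _; rewrite -mem_N // (valP v).
Qed.

(** Up to complement a vertex set avoids the new vertex; it is then a vertex set of [G] with the
    same number of cut edges. *)
Lemma cut3_contraction : cut3 contraction.
Proof.
suff main (A : {set contraction}) : None \notin A -> A != set0 -> 3 <= edges A (~: A).
  move=> A A0 AT; case: (boolP (None \in A)) => [nA|/main]; last exact.
  rewrite edgesC -{2}(setCK A); apply: main; first by rewrite inE nA.
  by apply: contra_neq AT => e; rewrite -(setCK A) e setC0.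
move=> nA A0; pose X := val @: [set v : T | Some v \in A].
have eX : edges A (~: A) = edges X (~: X).
  rewrite edges_sum big_mkcond big_option_nat (negbTE nA) add0n.
  rewrite [RHS]edges_sum big_imset; last by move=> ? ? _ _; apply: val_inj.
  rewrite [RHS]big_mkcond; apply: eq_bigr => u _; rewrite [u \in _]inE.
  case: ifP => // uA; rewrite edges_contraction !inE nA mul1n.
  rewrite -edgesUr.
    congr edges; apply/setP => z; rewrite !inE.
    case: (boolP (z \in S)) => [zS|zS].
      rewrite orbT; apply/esym/imsetP => [[v _ zv]].
      by have := valP v; rewrite -zv zS.
    rewrite orbF; apply/imsetP/idP => [[v]|zX].
      rewrite !inE => vA ->; rewrite (mem_imset _ _ val_inj) inE.
      exact: vA.
    exists (Sub z zS) => //; rewrite !inE; apply: contra zX => zA.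
    by apply/imsetP; exists (Sub z zS); rewrite ?inE.
  rewrite -setI_eq0; apply/eqP/setP => z; rewrite !inE.
  by apply/negP => /andP [/imsetP [v _ ->]]; apply/negP/(valP v).
have /set0Pn [[u|] uA] := A0; last by rewrite uA in nA.
have uX : val u \in X by apply/imset_f; rewrite inE.
have [s sS] : exists s, s \in S.
  by apply/set0Pn; apply/eqP => e; move: cS; rewrite e edges0.
rewrite eX; apply: (cut_ge3 hcut uX (y := s)).
by apply/imsetP => [[v _ sv]]; have := valP v; rewrite -sv sS.
Qed.

Lemma card_contraction : #|contraction| + #|S| = #|G| + 1.
Proof.
rewrite /= card_option card_sig -(cardsC S) addnC addnS addn1.
by congr (_ + _).+1; apply: eq_card => x; rewrite !inE.
Qed.

Definition contraction_colour (x : contraction) : bool :=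
  if x is Some u then c (val u) else b.

Lemma contraction_colourP (x y : contraction) :
  adj x y -> contraction_colour x != contraction_colour y.
Proof.
case: x y => [u|] [v|] //=; first exact: hc.
  rewrite (hN (valP u)) => /existsP [x /andP [xS xu]].
  by rewrite -(cout xS (valP u) xu) eq_sym; apply: hc.
rewrite (hN (valP v)) => /existsP [x /andP [xS xv]].
by rewrite -(cout xS (valP v) xv); apply: hc.
Qed.

(* The face entering S along [rev d] leaves it along [next_out d]. *)
Definition next_out d : dart G := odflt d [pick d' in out S | face d' == face (rev d)].

Let sS : exists s, s \in S.
Proof. by apply/set0Pn; apply/eqP => e; move: cS; rewrite e edges0. Qed.

Let tS : exists t, t \notin S.
Proof. by case/card_gt0P: (ltnW gt1) => t; rewrite inE; exists t. Qed.

Lemma next_outP d : d \in out S ->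
  next_out d \in out S /\ face (next_out d) = face (rev d).
Proof.
rewrite /next_out inE => /andP [td hd]; case: pickP => [d' /andP [d'S /eqP] //|no].
have n1 : face (rev d) \notin inner rot S.
  by apply: contra hd => /tail_inner.
have n2 : face (rev d) \notin inner rot (~: S).
  by apply: contraL td => /(head_inner hrot); rewrite head_rev inE.
case/imsetP: (crossing_face hrot n1 n2) => d' d'S e.
by have := no d'; rewrite /= d'S e eqxx.
Qed.

Lemma rev_out d : d \in out S -> rev d \in out (~: S).
Proof. by rewrite !inE head_rev negbK andbC. Qed.

(** [next_out d] determines the face of [rev d], and the faces crossing the cut are pairwise
    distinct. *)
Lemma next_out_inj : {in out S &, injective next_out}.
Proof.
case: sS tS => s0 s0S [t0 t0S] d d' dS d'S e.
apply: dart_rev_inj.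
have t1 : t0 \in ~: S by rewrite inE.
have s1 : s0 \notin ~: S by rewrite inE s0S.
have := face_out_inj hc hcub hcut hrot heul t1 s1 (cutC cS).
apply; rewrite ?rev_out //.
by case: (next_outP dS) (next_outP d'S) => _ <- [_ <-]; rewrite e.
Qed.

(** A fixed dart would have the same face on both sides, against [face_rev_neq]. *)
Lemma next_out_neq d : d \in out S -> next_out d != d.
Proof.
move=> dS; apply: contra_neq (face_rev_neq hc hcub hcut hrot heul d) => e.
by case: (next_outP dS) => _ <-; rewrite e.
Qed.

(* A derangement of three darts is a 3-cycle. *)
Lemma next_out_transitive d d' : d \in out S -> d' \in out S ->
  [\/ d' = d, d' = next_out d | d' = next_out (next_out d)].
Proof.
move=> dS d'S; have [d1S _] := next_outP dS; have [d2S _] := next_outP d1S.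
have n1 := next_out_neq dS; have n2 := next_out_neq d1S.
have n3 : next_out (next_out d) != d.
  apply/eqP => e.
  (* If [next_out] swapped two darts, no image would be left for the third one, [z]. *)
  have [z] : exists z, z \in out S :\: [set d; next_out d].
    apply/card_gt0P; rewrite cardsD (setIidPr _).
      by rewrite card_out cS cards2 subn_gt0; case: (_ != _).
    by apply/subsetP => y; rewrite !in_set2 => /orP [] /eqP ->.
  rewrite in_setD in_set2 negb_or => /andP [/andP [z1 z2] zS].
  have zn := next_out_neq zS; have [nzS _] := next_outP zS.
  have e3 : #|[set d; next_out d; z]| = #|out S|.
    by rewrite card_out cS setUC cardsU1 in_set2 (negbTE z1) (negbTE z2) cards2 eq_sym n1.
  have eS : [set d; next_out d; z] = out S.
    apply/eqP; rewrite eqEcard e3 leqnn andbT; apply/subsetP => y.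
    by rewrite !in_setU !in_set1 => /orP [/orP []|] /eqP ->.
  move: nzS; rewrite -eS !in_setU !in_set1 (negbTE zn) orbF => /orP [] /eqP ez.
    by move/eqP: z2; apply; apply: next_out_inj; rewrite // ez e.
  by move/eqP: z1; apply; apply: next_out_inj; rewrite // ez.
have eS : [set d; next_out d; next_out (next_out d)] = out S.
  apply/eqP; rewrite eqEcard card_out cS setUC cardsU1 in_set2 (negbTE n3) (negbTE n2).
  rewrite cards2 eq_sym n1 andbT setUC.
  by apply/subsetP => y; rewrite !in_setU !in_set1 => /orP [/orP []|] /eqP ->.
move: d'S; rewrite -eS !in_setU !in_set1 -orbA => /or3P [] /eqP ->.
- exact: Or31.
- exact: Or32.
- exact: Or33.
Qed.

(** [insub] sends tails in [S] to [None], which is precisely the contracted vertex. *)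
Definition contraction_tail d : contraction := insub (tail d).

Lemma planar_contraction : planar contraction.
Proof.
case: sS tS => s0 s0S [t0 t0S].
pose A := [set d | ~~ ((tail d \in S) && (head d \in S))].
(* At the new vertex [next_out] takes the place of the rotation. A face passing through [S] is
   short-circuited there and keeps its name [face], which serves as the invariant [k]. *)
pose n d := if tail d \in S then next_out d else rot d.
have outA d : d \in A -> tail d \in S -> d \in out S.
  by rewrite !inE => + tdS; rewrite tdS.
have Aout d : d \in out S -> d \in A.
  by rewrite !inE => /andP [_ /negbTE ->]; rewrite andbF.
have tailA d : tail d \notin S -> d \in A by rewrite !inE => /negbTE ->.
have tailout d : d \in out S -> tail d \in S by rewrite inE => /andP [].
have tailN d : tail d \in S -> contraction_tail d = None.
  by move=> h; rewrite /contraction_tail insubF // h.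
have tailS d (h : tail d \notin S) : contraction_tail d = Some (Sub (tail d) h : T).
  by rewrite /contraction_tail insubT.
have inj1 u v w : u \notin S -> v \in S -> w \in S -> adj u v -> adj u w -> v = w.
  move=> uS vS wS uv uw; have := edges_to_le1 uS; rewrite edges1_card.
  by move/card_le1_eqP => h; apply: h; rewrite inE ?vS ?wS.
apply: (@planar_of_map _ contraction_colour None _ _ A n (@rev G) contraction_tail face).
- exact: contraction_colourP.
- exact: cubic_contraction.
- exact: cut3_contraction.
- move=> d dA; rewrite /n; case: ifP => tdS.
    by apply: Aout; case: (next_outP (outA d dA tdS)).
  by apply: tailA; rewrite tail_rot // tdS.
- by move=> d; rewrite !inE head_rev andbC.
- move=> d d' dA d'A; rewrite /n; case: ifP => t1; case: ifP => t2.
  + by apply: next_out_inj; apply: outA.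
  + case: (next_outP (outA d dA t1)) => /tailout + _ e.
    by rewrite e tail_rot // t2.
  + case: (next_outP (outA d' d'A t2)) => /tailout + _ e.
    by rewrite -e tail_rot // t1.
  + exact: rotation_inj.
- move=> d dA; rewrite /n; case: ifP => t1.
    by rewrite !tailN //; apply: tailout; case: (next_outP (outA d dA t1)).
  by rewrite /contraction_tail tail_rot.
- move=> d d' dA d'A.
  have nE d1 : d1 \in out S -> n d1 = next_out d1 by move=> /tailout h; rewrite /n h.
  case t1: (tail d \in S).
    rewrite tailN //; case: (boolP (tail d' \in S)) => [t2 _|t2]; last by rewrite tailS.
    have dS := outA d dA t1; have [d1S _] := next_outP dS.
    case: (next_out_transitive dS (outA d' d'A t2)) => ->.
    + exact: connect0.
    + by rewrite -nE // fconnect1.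
    + by rewrite -(nE _ d1S) -nE //; apply: (fconnect_iter n 2).
  have tn : tail d \notin S by rewrite t1.
  rewrite tailS; case: (boolP (tail d' \in S)) => [t2|t2]; first by rewrite tailN.
  rewrite tailS => [[/eqP]]; rewrite -(proj2 hrot) => /iter_findex <-.
  suff -> m : iter m rot d = iter m n d by apply: fconnect_iter.
  elim: m => //= m <-; rewrite /n ifN //.
  by elim: m => //= m; rewrite (tail_rot hrot).
- by move=> d _; apply: dart_revK.
- move=> d dA; case: (boolP (tail d \in S)) => t1.
    have hd : tail (rev d) \notin S by move: dA; rewrite inE t1.
    rewrite tailN // tailS /= hN //; apply/existsP; exists (tail d).
    by rewrite t1; apply: adj_dart.
  case: (boolP (tail (rev d) \in S)) => t2.
    rewrite tailS tailN //= hN //; apply/existsP; exists (head d).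
    by rewrite t2 adj_sym; apply: adj_dart.
  by rewrite !tailS; apply: adj_dart.
- move=> d d' dA d'A; case: (boolP (tail d \in S)) => t1; case: (boolP (tail d' \in S)) => t1'.
  + have hd : tail (rev d) \notin S by move: dA; rewrite inE t1.
    have hd' : tail (rev d') \notin S by move: d'A; rewrite inE t1'.
    rewrite (tailS _ hd) (tailS _ hd') => _ [e]; apply: dart_inj => //; apply: (inj1 (head d)) => //.
      by rewrite adj_sym; apply: adj_dart.
    by rewrite /head e adj_sym; apply: adj_dart.
  + by rewrite tailN // tailS.
  + by rewrite tailS tailN.
  rewrite (tailS _ t1) (tailS _ t1') => [[e1]].
  case: (boolP (tail (rev d) \in S)) => t2; case: (boolP (tail (rev d') \in S)) => t2'.
  + move=> _; apply: dart_inj => //; apply: (inj1 (tail d)) => //; first exact: adj_dart.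
    by rewrite e1; apply: adj_dart.
  + by rewrite tailN // tailS.
  + by rewrite tailS tailN.
  + by rewrite (tailS _ t2) (tailS _ t2') => [[e2]]; apply: dart_inj.
- have := cardsC A; have := card_contraction; rewrite card_dart //.
  have -> : #|~: A| = edges S S.
    by rewrite -card_darts; apply: eq_card => d; rewrite !inE negbK.
  by have := edges_split hcub S S; rewrite cS; clear; lia.
- move=> d dA; rewrite /n; case: ifP => t1.
    have rA : rev d \in A by move: dA; rewrite !inE head_rev andbC.
    by case: (next_outP (outA _ rA t1)) => _ ->; rewrite dart_revK.
  by rewrite face_rot // dart_revK.
(* Only the faces inside [S] disappear. There are [(#|S| - 1) / 2] of them, while the number of
   vertices drops by [#|S| - 1], so Euler's count is preserved. *)
have sub : faces rot :\: inner rot S \subset face @: A.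
  apply/subsetP => r; rewrite in_setD => /andP [+ /imsetP [d _ e]].
  rewrite e => nd; have /existsP [d' /andP [/eqP e' t']] :
      [exists d', (face d' == face d) && (tail d' \notin S)].
    apply: contraNT nd; rewrite negb_exists => /forallP h.
    by apply/innerP => d' /eqP e'; have := h d'; rewrite e' negbK.
  by rewrite -e'; apply: imset_f; apply: tailA.
have := subset_leq_card sub; rewrite cardsD (setIidPr _); last first.
  by apply/subsetP => r; rewrite inE => /andP [].
have [e1 _] := inner_out_card hc hcub hcut hrot heul s0S t0S cS.
have := euler_faces hcub hcut hrot heul s0; have := card_contraction.
by move: e1; clear; lia.
Qed.

Lemma contraction_C3CBP : exists G' : sgraph,
  C3CBP G' /\ rel_iso (@adj G') (@add_vertex G S N).
Proof.
exists contraction; split; last by exists id; [exists id|].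
split.
- exact: cubic_contraction.
- apply: (cut3_three_connected cubic_contraction cut3_contraction).
  exact: (cubic_card_gt3 cubic_contraction (None : contraction)).
- by exists contraction_colour; apply: contraction_colourP.
- exact: planar_contraction.
Qed.

End Contraction.

(** * Four-cycles and the cuts crossing them *)

Lemma same_edgeC (T : eqType) (x y u v : T) : same_edge x y u v = same_edge y x u v.
Proof. by rewrite /same_edge orbC andbC [(x == u) && _]andbC. Qed.

Lemma add2_sym (G : sgraph) (S : {set G}) (u v w z : G) : symmetric (@add2 G S u v w z).
Proof. by move=> x y; rewrite /add2 adj_sym !(same_edgeC (val x)). Qed.

(** The neighbour lists are written cyclically, so that [quad_rot] carries every fact about one
    corner to the others. *)
Record quad (G : sgraph) (a1 a2 a3 a4 b1 b2 b3 b4 : G) : Prop := Quad {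
  quad_uniq : uniq [:: a1; a2; a3; a4];
  quad_adj1 : forall y, adj a1 y = (y \in [:: a4; a2; b1]);
  quad_adj2 : forall y, adj a2 y = (y \in [:: a1; a3; b2]);
  quad_adj3 : forall y, adj a3 y = (y \in [:: a2; a4; b3]);
  quad_adj4 : forall y, adj a4 y = (y \in [:: a3; a1; b4]);
  quad_out1 : b1 \notin [set a1; a2; a3; a4];
  quad_out2 : b2 \notin [set a1; a2; a3; a4];
  quad_out3 : b3 \notin [set a1; a2; a3; a4];
  quad_out4 : b4 \notin [set a1; a2; a3; a4]
}.

Lemma set4_rot (T : finType) (a1 a2 a3 a4 : T) : [set a2; a3; a4; a1] = [set a1; a2; a3; a4].
Proof. by rewrite setUC !setUA. Qed.

Lemma quad_rot (G : sgraph) (a1 a2 a3 a4 b1 b2 b3 b4 : G) :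
  quad a1 a2 a3 a4 b1 b2 b3 b4 -> quad a2 a3 a4 a1 b2 b3 b4 b1.
Proof.
case=> u n1 n2 n3 n4 o1 o2 o3 o4; split; rewrite 1?set4_rot //.
by rewrite -(rot_uniq 3).
Qed.

(* The cuts that prevent the reduction adding the edges b1 b2 and b3 b4. *)
Definition splitter (G : sgraph) (S : {set G}) (b1 b2 b3 b4 : G) (X : {set G}) : bool :=
  [&& X \subset ~: S, b1 \in X, b2 \in X, b3 \notin X, b4 \notin X
    & edges X (~: (S :|: X)) <= 2].

Section Quad.
Variable G : sgraph.
Implicit Types (A B X : {set G}) (x y : G).

Variable c : G -> bool.
Hypothesis hc : forall x y, adj x y -> c x != c y.
Hypothesis hcub : cubic G.
Hypothesis hcut : cut3 G.

Section Quad1.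
Variables a1 a2 a3 a4 b1 b2 b3 b4 : G.
Hypothesis hq : quad a1 a2 a3 a4 b1 b2 b3 b4.

Notation S := [set a1; a2; a3; a4].

Lemma quad_adj_b1 : adj a1 b1.
Proof. by rewrite (quad_adj1 hq) !inE eqxx !orbT. Qed.

Lemma edges_to_quad1 A : A \subset ~: S -> edges A [set a1] = (b1 \in A).
Proof.
move=> AS; rewrite edgesC edges1_card; case bA: (b1 \in A).
  suff -> : [set y in A | adj a1 y] = [set b1] by rewrite cards1.
  apply/setP => y.
  rewrite [RHS]inE inE (quad_adj1 hq) !inE; case: (y =P b1) => [->|_].
    by rewrite bA !orbT.
  rewrite orbF; apply/negP => /andP [/(subsetP AS) yS].
  by move=> /orP [] /eqP e; move: yS; rewrite e !inE eqxx ?orbT.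
apply/eqP; rewrite cards_eq0; apply/eqP/setP => y.
rewrite [RHS]inE inE (quad_adj1 hq) !inE; apply/negP => /andP [yA].
move=> /or3P [] /eqP e; first 2 last.
- by rewrite -e yA in bA.
- by move: (subsetP AS _ yA); rewrite e !inE eqxx ?orbT.
- by move: (subsetP AS _ yA); rewrite e !inE eqxx ?orbT.
Qed.

End Quad1.

Section Quad2.
Variables a1 a2 a3 a4 b1 b2 b3 b4 : G.
Hypothesis hq : quad a1 a2 a3 a4 b1 b2 b3 b4.

Notation S := [set a1; a2; a3; a4].

Let hq2 := quad_rot hq.
Let hq3 := quad_rot hq2.
Let hq4 := quad_rot hq3.

Lemma edges_to_quad A : A \subset ~: S ->
  edges A S = (b1 \in A) + (b2 \in A) + (b3 \in A) + (b4 \in A).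
Proof.
move=> AS; rewrite edgesC.
have := quad_uniq hq; rewrite /= !inE !negb_or andbT => /and3P [/and3P [n12 n13 n14] /andP [n23 n24] n34].
have dj2 : [disjoint [set a1] & [set a2]] by rewrite disjoints1 inE.
have dj3 : [disjoint [set a1; a2] & [set a3]].
  by rewrite disjoint_sym disjoints1 !inE negb_or !(eq_sym a3) n13.
have dj4 : [disjoint [set a1; a2; a3] & [set a4]].
  by rewrite disjoint_sym disjoints1 !inE !negb_or !(eq_sym a4) n14 n24.
rewrite !edgesUl //.
have A2 : A \subset ~: [set a2; a3; a4; a1] by rewrite set4_rot.
have A3 : A \subset ~: [set a3; a4; a1; a2] by rewrite 2!set4_rot.
have A4 : A \subset ~: [set a4; a1; a2; a3] by rewrite 3!set4_rot.
rewrite !(edgesC [set _]) (edges_to_quad1 hq) // (edges_to_quad1 hq2) //.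
by rewrite (edges_to_quad1 hq3) // (edges_to_quad1 hq4).
Qed.

Lemma card_quad : #|S| = 4.
Proof.
have -> : S = [set x in [:: a1; a2; a3; a4]] by apply/setP => x; rewrite !inE !orbA.
by rewrite cardsE (card_uniqP (quad_uniq hq)).
Qed.

Lemma edges_quad : edges S S = 8.
Proof.
have := edges_split hcub S S; rewrite (edgesC S (~: S)) card_quad.
rewrite (edges_to_quad (subxx _)) !in_setC (quad_out1 hq) (quad_out2 hq) (quad_out3 hq) (quad_out4 hq).
by clear; lia.
Qed.

Lemma colour_b12 : c b1 != c b2.
Proof.
have := hc (quad_adj_b1 hq); have := hc (quad_adj_b1 hq2).
have : adj a1 a2 by rewrite (quad_adj1 hq) !inE eqxx orbT.
by move/hc; do 4 case: (c _).
Qed.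

Lemma b12_neq : b1 != b2.
Proof. by apply: contra_neq colour_b12 => ->. Qed.

Hypothesis hord : 8 < #|G|.

(** The cut around the face together with [b1] and [b2] has 6 edges in general, and each of the
    three coincidences lowers this by 2. Some vertex lies outside, so at least 3 edges must
    remain. *)
Lemma quad_pair_bound :
  (b3 \in [set b1; b2]) + (b4 \in [set b1; b2]) + adj b1 b2 <= 1.
Proof.
pose X := [set b1; b2].
have XS : X \subset ~: S.
  by apply/subsetP => x; rewrite in_set2 => /orP [] /eqP ->; rewrite in_setC ?(quad_out1 hq) ?(quad_out2 hq).
have dSX : [disjoint S & X] by rewrite disjoint_sym disjoints_subset.
have cX : #|X| = 2 by rewrite cards2 b12_neq.
have [w] : exists w, w \in ~: (S :|: X).
  apply/card_gt0P; have := cardsC (S :|: X).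
  by rewrite cardsU (disjoint_setI0 dSX) cards0 card_quad cX; move: hord; clear; lia.
rewrite in_setC => wSX.
have a1S : a1 \in S :|: X by rewrite !inE eqxx.
have := cut_ge3 hcut a1S wSX.
have := edges_split hcub (S :|: X) (S :|: X).
have eXX : edges X X = 2 * adj b1 b2.
  rewrite edgesUl ?disjoints1 ?inE ?b12_neq // !edgesUr ?disjoints1 ?inE ?b12_neq //.
  by rewrite !edges11 !adj_irrefl (adj_sym b2) addn0 mul2n -addnn.
rewrite cardsU (disjoint_setI0 dSX) cards0 subn0 card_quad cX.
rewrite !(edgesUl _ dSX) !(edgesUr _ dSX) edges_quad (edgesC S X) edges_to_quad // eXX.
rewrite /X !in_set2 !eqxx orbT /=.
by move: (_ || _) (_ || _) (adj _ _) => p q r; clear; lia.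
Qed.

(** If [b1] and [b2] were adjacent, [[set b1; b2]] would itself be a splitter: two of its six edge
    ends are used inside, two go to the face, two remain. *)
Lemma no_splitter_not_adj :
  (forall X, ~~ splitter S b1 b2 b3 b4 X) -> ~~ adj b1 b2.
Proof.
move=> nosp; apply/negP => b12.
have := quad_pair_bound; rewrite b12.
case h3: (b3 \in [set b1; b2]) => //; case h4: (b4 \in [set b1; b2]) => // _.
have /negP := nosp [set b1; b2]; apply; rewrite /splitter h3 h4 !set21 !set22 /=.
pose X := [set b1; b2]; rewrite -/X.
have XS : X \subset ~: S.
  by apply/subsetP => x; rewrite in_set2 => /orP [] /eqP ->; rewrite in_setC ?(quad_out1 hq) ?(quad_out2 hq).
rewrite XS /=.
have eXX : edges X X = 2.
  rewrite edgesUl ?disjoints1 ?inE ?b12_neq // !edgesUr ?disjoints1 ?inE ?b12_neq //.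
  by rewrite !edges11 !adj_irrefl (adj_sym b2) b12.
have dSX : [disjoint S & X] by rewrite disjoint_sym disjoints_subset.
have := edges_split hcub X (S :|: X); rewrite (edgesUr _ dSX) eXX edges_to_quad //.
by rewrite cards2 b12_neq h3 h4 set21 set22; clear; lia.
Qed.

(** This keeps the two added edges from being parallel; the other way of coinciding, [b1 = b4] with
    [b2 = b3], is excluded by colours. *)
Lemma quad_pairs_neq : ~~ ((b1 == b3) && (b2 == b4)).
Proof.
apply/negP => /andP [/eqP e1 /eqP e2]; have := quad_pair_bound.
by rewrite -e1 -e2 set21 set22.
Qed.

End Quad2.
End Quad.

(** * The reduction of a 4-face *)

Lemma sum_eq1 (T : finType) (B : {set T}) (q : T) : \sum_(v in B) (v == q : nat) = (q \in B).
Proof.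
case qB: (q \in B).
  rewrite (bigD1 q) //= eqxx big1 // => v /andP [_ /negbTE ->] //.
by rewrite big1 // => v vB; case: eqP => // e; rewrite -e vB in qB.
Qed.

Lemma sum_same_edge (T : finType) (A B : {set T}) (p q : T) : p != q ->
  \sum_(u in A) \sum_(v in B) (same_edge u v p q : nat)
    = (p \in A) * (q \in B) + (q \in A) * (p \in B).
Proof.
move=> pq; have E u v : same_edge u v p q = (u == p) * (v == q) + (u == q) * (v == p) :> nat.
  rewrite /same_edge; case: (u =P p) => [->|_]; first by rewrite (negbTE pq); case: (v == q).
  by case: (u == q); case: (v == p).
under eq_bigr => u _ do (under eq_bigr => v _ do rewrite E).
under eq_bigr => u _ do rewrite big_split -!big_distrr /= !sum_eq1.
by rewrite big_split -!big_distrl /= !sum_eq1.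
Qed.

Section FourFace.
Variable G : sgraph.
Implicit Types (A B X : {set G}) (x y : G) (d : dart G).

Variable c : G -> bool.
Hypothesis hc : forall x y, adj x y -> c x != c y.
Hypothesis hcub : cubic G.
Hypothesis hcut : cut3 G.
Variable rot : dart G -> dart G.
Hypothesis hrot : rotation rot.

Notation f := (face_step rot).
Notation face := (face rot).

(** * The three darts at a corner of a face *)

Section Corner.
Variables (p q : dart G).
Hypothesis pq : f p = q.

Lemma corner_rot : rot (rot q) = rev p.
Proof. by rewrite -pq /face_step rot3. Qed.

Lemma corner_tail : tail q = head p.
Proof. by rewrite -pq tail_face. Qed.

Lemma corner_darts d : tail d = tail q -> [\/ d = q, d = rot q | d = rev p].
Proof. by rewrite -corner_rot; apply: same_tail. Qed.

Lemma corner_adj y : adj (tail q) y = (y \in [:: tail p; head q; head (rot q)]).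
Proof.
apply/idP/idP => [qy|].
  have e : tail (mkdart qy) = tail q by [].
  have -> : y = head (mkdart qy) by [].
  rewrite !inE; case: (corner_darts e) => ->; rewrite ?eqxx ?orbT //.
rewrite !inE => /or3P [] /eqP ->.
- by rewrite corner_tail adj_sym; apply: adj_dart.
- exact: adj_dart.
- by rewrite -(tail_rot hrot); apply: adj_dart.
Qed.

Lemma tail_ff_neq : tail (f q) != tail p.
Proof.
apply/eqP; rewrite tail_face // => e; have /eqP := rot_neq hcub hrot (rev p); apply.
rewrite -[rot _]/(f p) pq; apply: dart_inj; first by rewrite corner_tail.
by rewrite head_rev.
Qed.

End Corner.

Variables d1 d2 d3 d4 : dart G.
Hypotheses (h1 : f d1 = d2) (h2 : f d2 = d3) (h3 : f d3 = d4) (h4 : f d4 = d1).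

Notation a1 := (tail d1).
Notation a2 := (tail d2).
Notation a3 := (tail d3).
Notation a4 := (tail d4).
Notation b1 := (head (rot d1)).
Notation b2 := (head (rot d2)).
Notation b3 := (head (rot d3)).
Notation b4 := (head (rot d4)).

Notation S := [set a1; a2; a3; a4].

(** Simplicity excludes the two neighbouring corners, the colouring excludes the opposite one. *)
Let out4 (p q r s : dart G) : f p = q -> f q = r -> f r = s -> f s = p ->
  head (rot q) \notin [set tail p; tail q; tail r; tail s].
Proof.
move=> pq qr rs sp; have tr := tail_rot hrot q.
rewrite !inE !negb_or; apply/andP; split; [apply/andP; split; [apply/andP; split|]|].
- apply/eqP => e; have /eqP := rot_neq hcub hrot (rot q); apply.
  rewrite (corner_rot pq); apply: dart_inj; first by rewrite tr (corner_tail pq).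
  by rewrite head_rev e.
- apply/eqP => e; have := adj_dart (rot q); by rewrite tr e adj_irrefl.
- apply/eqP => e; have /eqP := rot_neq hcub hrot q; apply.
  by apply: dart_inj; rewrite // e (corner_tail qr).
- apply/eqP => e; have := hc (adj_dart (rot q)); rewrite tr e.
  have := hc (adj_dart q); rewrite -(corner_tail qr); have := hc (adj_dart r).
  by rewrite -(corner_tail rs); do 3 case: (c _).
Qed.

Lemma quad_of_face : quad a1 a2 a3 a4 b1 b2 b3 b4.
Proof.
split.
- rewrite /= !inE !negb_or; have n13 := tail_ff_neq h1; have n24 := tail_ff_neq h2.
  rewrite h2 eq_sym in n13; rewrite h3 eq_sym in n24; rewrite n13 n24 !andbT /=.
  have nn (p q : dart G) : f p = q -> tail p != tail q.
    move=> pq; rewrite (corner_tail pq); apply/eqP => e.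
    by have := adj_dart p; rewrite -e adj_irrefl.
  by rewrite (nn _ _ h1) (nn _ _ h2) (nn _ _ h3) eq_sym (nn _ _ h4).
- by move=> y; rewrite (corner_adj h4) (corner_tail h1).
- by move=> y; rewrite (corner_adj h1) (corner_tail h2).
- by move=> y; rewrite (corner_adj h2) (corner_tail h3).
- by move=> y; rewrite (corner_adj h3) (corner_tail h4).
- by rewrite -3!set4_rot out4.
- by rewrite out4.
- by rewrite -set4_rot out4.
- by rewrite -2!set4_rot out4.
Qed.

Let hq := quad_of_face.
Let hq3 := quad_rot (quad_rot hq).

Lemma is_face_four : is_face rot [:: a1; a2; a3; a4].
Proof.
exists [:: d1; d2; d3; d4] => //; apply/andP; split; first by rewrite /= h1 h2 h3 h4 !eqxx.
by apply: (@map_uniq _ _ (@tail G)); apply: quad_uniq hq.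
Qed.

(** * The reduced graph in the absence of splitters *)

Hypothesis heul : euler_sphere rot.
Hypothesis hord : 8 < #|G|.
Hypothesis nosp : forall X, ~~ splitter S b1 b2 b3 b4 X.

Notation T := (delete S).

Let n12 : b1 != b2 := b12_neq hc hq.
Let n34 : b3 != b4 := b12_neq hc hq3.
Let na12 : ~~ adj b1 b2 := no_splitter_not_adj hc hcub hcut hq hord nosp.

(** Taking the complement outside [S] exchanges the two pairs and keeps the edge count. *)
Let nosp3 X : ~~ splitter S b3 b4 b1 b2 X.
Proof.
apply/negP => /and5P [XS b3X b4X b1X /andP [b2X le2]].
have /negP := nosp (~: (S :|: X)); apply.
have eX : ~: (S :|: ~: (S :|: X)) = X.
  by rewrite setCU setCK setIUr (setIC (~: S)) setICr set0U; apply/setIidPr.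
rewrite /splitter eX edgesC le2 subsetC setCK subsetUl /=.
have bX b : b \notin S -> (b \in ~: (S :|: X)) = (b \notin X).
  by move=> bS; rewrite in_setC in_setU (negbTE bS).
rewrite !bX ?(quad_out1 hq) ?(quad_out2 hq) ?(quad_out3 hq) ?(quad_out4 hq) //.
by rewrite b1X b2X b3X b4X.
Qed.

Let na34 : ~~ adj b3 b4.
Proof.
apply: (no_splitter_not_adj hc hcub hcut hq3 hord) => X.
by rewrite 2!set4_rot.
Qed.

Let n1234 : ~~ ((b1 == b3) && (b2 == b4)) := quad_pairs_neq hc hcub hcut hq hord.

Let cb : [/\ c b1 != c b2, c b2 != c b3, c b3 != c b4 & c b4 != c b1].
Proof.
split; [exact: (colour_b12 hc hq) | exact: (colour_b12 hc (quad_rot hq)) |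
  exact: (colour_b12 hc hq3) | exact: (colour_b12 hc (quad_rot hq3))].
Qed.

Let ne (x y : G) : c x != c y -> x != y.
Proof. by apply: contra_neq => ->. Qed.

Lemma add2_irrefl : irreflexive (@add2 G S b1 b2 b3 b4).
Proof.
have diag p q x : p != q -> same_edge x x p q = false.
  rewrite /same_edge orbC andbC orbb => /negbTE npq.
  by case: (x =P p) => // ->; rewrite npq.
by move=> x; rewrite /add2 adj_irrefl !diag.
Qed.

Definition quad_reduction : sgraph :=
  SGraph (@add2_sym G S b1 b2 b3 b4) add2_irrefl.

(** The alternatives in [add2] exclude each other, as the added edges are parallel neither to old
    edges nor to one another; this makes edge counts additive. *)
Lemma add2_nat (u v : T) : @add2 G S b1 b2 b3 b4 u v =
  adj (val u) (val v) + same_edge (val u) (val v) b1 b2 + same_edge (val u) (val v) b3 b4 :> nat.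
Proof.
rewrite /add2 /= /del_adj /same_edge.
have [c12 c23 c34 c41] := cb.
have n23 := ne c23; have n41 := ne c41.
case uv: (adj _ _) => /=.
  have no p q : ~~ adj p q -> (\val u == p) && (\val v == q) = false.
    by move=> npq; apply/negP => /andP [/eqP e1 /eqP e2]; rewrite -e1 -e2 uv in npq.
  by rewrite !no ?orbF // adj_sym.
case: (val u =P b1) => [->|_] /=.
  rewrite (negbTE n12) /= orbF (eq_sym b1 b4) (negbTE n41) /= orbF.
  case: (val v =P b2) => [->|_] //=.
  by have := n1234; case: (b1 == b3) => //= /negbTE ->.
case: (val u =P b2) => [->|_] //=.
rewrite (negbTE n23) /=; case: (val v =P b1) => [->|_] //=.
by have := n1234; rewrite andbC; case: (b2 == b4) => //= /negbTE ->.
Qed.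

Lemma edges_quad_reduction (A B : {set quad_reduction}) :
  let A' := val @: (A : {set T}) in let B' := val @: (B : {set T}) in
  edges A B = edges A' B'
    + ((b1 \in A') * (b2 \in B') + (b2 \in A') * (b1 \in B'))
    + ((b3 \in A') * (b4 \in B') + (b4 \in A') * (b3 \in B')).
Proof.
have vinj (C : {set T}) : {in C &, injective val} by move=> ? ? _ _; apply: val_inj.
rewrite /= -!sum_same_edge // /edges !(big_imset _ (@vinj _)) /= -!big_split /=.
apply: eq_bigr => u _; rewrite !(big_imset _ (@vinj _)) /= -!big_split /=.
by apply: eq_bigr => v _; rewrite add2_nat.
Qed.

Lemma val_imsetT : val @: [set: T] = ~: S.
Proof.
apply/setP => z; rewrite inE; apply/imsetP/idP => [[v _ ->]|zS]; first exact: valP v.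
by exists (Sub z zS); rewrite ?inE.
Qed.

Lemma val_imsetC (A : {set T}) : val @: (~: A) = ~: S :\: val @: A.
Proof.
apply/setP => z; rewrite inE; apply/imsetP/andP => [[v]|[zA]].
  by rewrite inE => vA ->; rewrite (mem_imset _ _ val_inj) inE (valP v).
rewrite inE => zS; exists (Sub z zS) => //.
by rewrite inE; apply: contra zA => h; apply/imsetP; exists (Sub z zS).
Qed.

Lemma val_imset_sub (A : {set T}) : val @: A \subset ~: S.
Proof. by rewrite -val_imsetT; apply: imsetS; apply: subsetT. Qed.

Lemma cubic_quad_reduction : cubic quad_reduction.
Proof.
move=> x; transitivity (edges [set x] setT).
  by rewrite edges1_card; apply: eq_card => y; rewrite !inE.
rewrite edges_quad_reduction /= val_imsetT !in_setC.
rewrite (quad_out1 hq) (quad_out2 hq) (quad_out3 hq) (quad_out4 hq) !muln1.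
have := edges_split hcub (val @: [set (x : T)]) S.
rewrite (edges_to_quad hq) ?val_imset_sub // imset_set1 cards1.
by clear; lia.
Qed.

(** A cut of the reduced graph is as large as the smaller of the two cuts of [G] around its sides,
    since each stub on the side with fewer stubs is matched by a separated new edge. The only
    exception has [b1], [b2] on one side and [b3], [b4] on the other, which is the case of a
    splitter. *)
Lemma cut3_quad_reduction : cut3 quad_reduction.
Proof.
move=> A A0 AT; rewrite leqNgt; apply/negP; rewrite edges_quad_reduction /= val_imsetC.
pose X := val @: (A : {set T}); pose Y := ~: S :\: X; rewrite -/X -/Y.
have XS : X \subset ~: S by apply: val_imset_sub.
have YS : Y \subset ~: S by apply: subsetDl.
have eY : ~: (S :|: X) = Y by rewrite /Y setDE setCU.
have eX : ~: (S :|: Y) = X.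
  by rewrite -eY setCU setCK setIUr (setIC (~: S)) setICr set0U; apply/setIidPr.
have [x xX] : exists x, x \in X.
  by case/set0Pn: A0 => u uA; exists (val u); apply: imset_f.
have [y yY] : exists y, y \in Y.
  have /set0Pn [u uA] : ~: A != set0 by apply: contra_neq AT => e; rewrite -(setCK A) e setC0.
  by exists (val u); rewrite /Y -val_imsetC; apply: imset_f.
have a1X : a1 \notin X by apply/negP => /(subsetP XS); rewrite !inE eqxx.
have a1Y : a1 \notin Y by apply/negP => /(subsetP YS); rewrite !inE eqxx.
have := cut_ge3 hcut xX a1X; have := cut_ge3 hcut yY a1Y.
have dS (Z : {set G}) : Z \subset ~: S -> [disjoint S & Z].
  by rewrite disjoint_sym disjoints_subset.
have -> : ~: X = S :|: Y by rewrite -eX setCK.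
have -> : ~: Y = S :|: X by rewrite -eY setCK.
rewrite !(edgesUr _ (dS _ XS)) !(edgesUr _ (dS _ YS)) !(edges_to_quad hq) // (edgesC Y X).
have := nosp X; have := nosp Y; rewrite /splitter XS YS eX eY (edgesC Y X) /=.
have bY b : b \notin S -> (b \in Y) = (b \notin X) by rewrite /Y in_setD !in_setC => ->; rewrite andbT.
rewrite !bY ?(quad_out1 hq) ?(quad_out2 hq) ?(quad_out3 hq) ?(quad_out4 hq) // !negbK.
case: (b1 \in X); case: (b2 \in X); case: (b3 \in X); case: (b4 \in X) => /=;
  clear; lia.
Qed.

Definition quad_colour (x : quad_reduction) : bool := c (val (x : T)).

Lemma quad_colourP (x y : quad_reduction) : adj x y -> quad_colour x != quad_colour y.
Proof.
have [c12 _ c34 _] := cb.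
rewrite /quad_colour => /or3P [|/orP []|/orP []]; first exact: hc.
- by move=> /andP [/eqP -> /eqP ->].
- by move=> /andP [/eqP -> /eqP ->]; rewrite eq_sym.
- by move=> /andP [/eqP -> /eqP ->].
- by move=> /andP [/eqP -> /eqP ->]; rewrite eq_sym.
Qed.

Lemma card_quad_reduction : #|quad_reduction| + 4 = #|G|.
Proof.
rewrite /= card_sig -(card_quad hq) -(cardsC S) addnC.
by congr (_ + _); apply: eq_card => x; rewrite !inE.
Qed.

(* The darts of the reduced graph are the darts of G with tail outside the face;
   the four stubs b_i -> a_i are paired anew. *)
Definition stub_swap d : dart G :=
  if d == rev (rot d1) then rev (rot d2) else
  if d == rev (rot d2) then rev (rot d1) else
  if d == rev (rot d3) then rev (rot d4) else
  if d == rev (rot d4) then rev (rot d3) else rev d.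

Let stub_neq (p q : dart G) : tail p != tail q -> (rev (rot p) == rev (rot q)) = false.
Proof.
move=> npq; apply/negP => /eqP /(@dart_rev_inj G) e.
by move: npq; rewrite -(tail_rot hrot p) e tail_rot // eqxx.
Qed.

Let neqs : [/\ a1 != a2, a1 != a3, a1 != a4, a2 != a3 & (a2 != a4) && (a3 != a4)].
Proof.
have := quad_uniq hq; rewrite /= !inE !negb_or andbT.
by case/and3P => /and3P [-> -> ->] /andP [-> ->] ->.
Qed.

Inductive stub_spec d : dart G -> Type :=
| Stub1 of d = rev (rot d1) : stub_spec d (rev (rot d2))
| Stub2 of d = rev (rot d2) : stub_spec d (rev (rot d1))
| Stub3 of d = rev (rot d3) : stub_spec d (rev (rot d4))
| Stub4 of d = rev (rot d4) : stub_spec d (rev (rot d3))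
| NoStub of head d \notin S : stub_spec d (rev d).

Let tail_edge d : tail (rev d) \in S -> tail d \notin S ->
  [\/ d = rev (rot d1), d = rev (rot d2), d = rev (rot d3) | d = rev (rot d4)].
Proof.
move=> hS tS.
have sol (p q : dart G) : f p = q -> tail p \in S -> tail q \in S -> head q \in S ->
    tail (rev d) = tail q -> d = rev (rot q).
  move=> pq pS qS hqS e; case: (corner_darts pq e) => e'.
  - by move: tS; rewrite -head_rev e' hqS.
  - by rewrite -e' dart_revK.
  - by move: tS; rewrite -(dart_revK d) e' dart_revK pS.
have [S1 S2 S3 S4] : [/\ a1 \in S, a2 \in S, a3 \in S & a4 \in S] by rewrite !inE !eqxx !orbT.
have := hS; rewrite !inE => /orP [/orP [/orP []|]|] /eqP e.
- by apply: Or41; apply: (sol _ _ h4); rewrite -?(corner_tail h1).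
- by apply: Or42; apply: (sol _ _ h1); rewrite -?(corner_tail h2).
- by apply: Or43; apply: (sol _ _ h2); rewrite -?(corner_tail h3).
- by apply: Or44; apply: (sol _ _ h3); rewrite -?(corner_tail h4).
Qed.

Let swapE :
  [/\ stub_swap (rev (rot d1)) = rev (rot d2), stub_swap (rev (rot d2)) = rev (rot d1),
      stub_swap (rev (rot d3)) = rev (rot d4) & stub_swap (rev (rot d4)) = rev (rot d3)].
Proof.
case: neqs => n1_2 n1_3 n1_4 n2_3 /andP [n2_4 n3_4].
by rewrite /stub_swap !eqxx !stub_neq // eq_sym.
Qed.

Let stubP d : tail d \notin S -> stub_spec d (stub_swap d).
Proof.
move=> tS; rewrite /stub_swap.
case: eqP => [->|x1]; first exact: Stub1.
case: eqP => [->|x2]; first exact: Stub2.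
case: eqP => [->|x3]; first exact: Stub3.
case: eqP => [->|x4]; first exact: Stub4.
by apply: NoStub; apply/negP => hS; case: (tail_edge hS tS).
Qed.

(** With [before] this locates the four faces around the 4-face: the one across the edge from [a_i]
    to [a_(i+1)], which is [face (rev d_i)], runs along the stubs at both ends. *)
Let across : [/\ face (rot d1) = face (rev d1), face (rot d2) = face (rev d2),
   face (rot d3) = face (rev d3) & face (rot d4) = face (rev d4)].
Proof. by rewrite !(face_rot hrot). Qed.

Let before : [/\ face (rev (rot d1)) = face (rev d4), face (rev (rot d2)) = face (rev d1),
   face (rev (rot d3)) = face (rev d2) & face (rev (rot d4)) = face (rev d3)].
Proof.
rewrite -!(face_rot hrot (rot _)) !(corner_rot h1, corner_rot h2) //.
by rewrite (corner_rot h3) (corner_rot h4).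
Qed.

Lemma planar_quad_reduction : planar quad_reduction.
Proof.
pose A := [set d | tail d \notin S].
have inA d : (d \in A) = (tail d \notin S) by rewrite in_set.
pose x0 : T := Sub b1 (quad_out1 hq).
pose t d : quad_reduction := insubd x0 (tail d).
have tE d : d \in A -> val (t d : T) = tail d by rewrite inA => dA; apply: insubdK.
have t_eq d d' : d \in A -> d' \in A -> t d = t d' -> tail d = tail d'.
  by move=> dA d'A e; rewrite -(tE _ dA) -(tE _ d'A) e.
have stubA : [/\ rev (rot d1) \in A, rev (rot d2) \in A, rev (rot d3) \in A & rev (rot d4) \in A].
  by rewrite !inA; split; [exact: quad_out1 hq | exact: quad_out2 hq
    | exact: quad_out3 hq | exact: quad_out4 hq].
have eA d : d \in A -> stub_swap d \in A.
  rewrite inA => dS; have [A1 A2 A3 A4] := stubA.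
  by case: (stubP dS) => // hS; rewrite inA.
have [s1 s2 s3 s4] := swapE.
have [c12 c23 c34 c41] := cb.
(* The new edges run along [a1 a2] and [a3 a4], so the faces across the other two edges of the
   4-face merge into one; [k] identifies them. *)
pose P := face (rev d2); pose R := face (rev d4).
pose k d := if face d == P then R else face d.
have kE d d' : face d = face d' -> k d = k d' by rewrite /k => ->.
have teE d d' : d \in A -> d' \in A -> adj (t d) (t d') =
    [|| adj (tail d) (tail d'), same_edge (tail d) (tail d') b1 b2
      | same_edge (tail d) (tail d') b3 b4].
  by move=> dA d'A; rewrite -(tE _ dA) -(tE _ d'A).
apply: (@planar_of_map _ quad_colour x0 _ _ A rot stub_swap t k).
- exact: quad_colourP.
- exact: cubic_quad_reduction.
- exact: cut3_quad_reduction.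
- by move=> d; rewrite !inA tail_rot.
- exact: eA.
- by move=> d d' _ _; apply: rotation_inj hrot _ _.
- by move=> d _; rewrite /t tail_rot.
- by move=> d d' dA d'A /(t_eq _ _ dA d'A) e; rewrite (proj2 hrot) e.
- move=> d; rewrite inA => dS.
  case: (stubP dS) => [->|->|->|->|hd]; rewrite ?s1 ?s2 ?s3 ?s4 //.
  have nr q : tail q \in S -> rev d <> rev (rot q).
    by move=> qS /(@dart_rev_inj G) e; move: dS; rewrite e tail_rot // qS.
  have [S1 S2 S3 S4] : [/\ a1 \in S, a2 \in S, a3 \in S & a4 \in S] by rewrite !inE !eqxx !orbT.
  case: (stubP hd) => [/(nr _ S1)|/(nr _ S2)|/(nr _ S3)|/(nr _ S4)|] //.
  by rewrite dart_revK.
- move=> d dA; rewrite teE ?eA //; move: dA; rewrite inA => dS.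
  case: (stubP dS) => [->|->|->|->|_]; rewrite /same_edge ?eqxx ?orbT //.
  by rewrite adj_dart.
- move=> d d' dA d'A /(t_eq _ _ dA d'A) + /(t_eq _ _ (eA _ dA) (eA _ d'A)).
  move: dA d'A; rewrite !inA => dS d'S.
  have x12 : b1 <> b2 := elimN eqP n12.
  have x34 : b3 <> b4 := elimN eqP n34.
  have x23 : b2 <> b3 := elimN eqP (ne c23).
  have x41 : b4 <> b1 := elimN eqP (ne c41).
  have x13 : b1 = b3 -> b2 <> b4.
    by move=> e1 e2; have := n1234; rewrite e1 e2 !eqxx.
  have y12 q : tail q = b1 -> head q <> b2.
    by move=> e1 e2; have := adj_dart q; rewrite e1 e2 (negbTE na12).
  have y21 q : tail q = b2 -> head q <> b1.
    by move=> e1 e2; have := adj_dart q; rewrite e1 e2 adj_sym (negbTE na12).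
  have y34 q : tail q = b3 -> head q <> b4.
    by move=> e1 e2; have := adj_dart q; rewrite e1 e2 (negbTE na34).
  have y43 q : tail q = b4 -> head q <> b3.
    by move=> e1 e2; have := adj_dart q; rewrite e1 e2 adj_sym (negbTE na34).
  (* A coincidence of two darts would make a new edge parallel to an old one, against [na12] and
     [na34], or to the other new one, against the colours and [n1234]. *)
  case: (stubP dS) => [->|->|->|->|_]; case: (stubP d'S) => [->|->|->|->|_] e1 e2;
    first [ done | by case: (x12 e1) | by case: (x12 (esym e1)) | by case: (x23 e1)
      | by case: (x23 (esym e1)) | by case: (x34 e1) | by case: (x34 (esym e1))
      | by case: (x41 e1) | by case: (x41 (esym e1)) | by case: (x13 e1 e2)
      | by case: (x13 (esym e1) (esym e2)) | by case: (x13 e2 e1)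
      | by case: (x13 (esym e2) (esym e1))
      | by case: (y12 _ e1 e2) | by case: (y12 _ (esym e1) (esym e2))
      | by case: (y21 _ e1 e2) | by case: (y21 _ (esym e1) (esym e2))
      | by case: (y34 _ e1 e2) | by case: (y34 _ (esym e1) (esym e2))
      | by case: (y43 _ e1 e2) | by case: (y43 _ (esym e1) (esym e2))
      | exact: dart_inj e1 e2 ].
- have -> : #|A| = edges (~: S) setT.
    by rewrite -card_darts; apply: eq_card => d; rewrite inA [RHS]in_set in_setC in_setT andbT.
  rewrite edges_setT //; congr (3 * _); apply/eqP.
  by rewrite -(eqn_add2r 4) card_quad_reduction -(cardsC S) (card_quad hq) addnC.
- move=> d; rewrite inA => dS; have [r1 r2 r3 r4] := across; have [v1 v2 v3 v4] := before.
  have kP d' : face d' = P -> k d' = R by rewrite /k => ->; rewrite eqxx.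
  have kR d' : face d' = R -> k d' = R by rewrite /k => ->; case: eqP.
  have fr d' : face (rot (rev d')) = face d' by rewrite face_rot // dart_revK.
  case: (stubP dS) => [->|->|->|->|_].
  + by rewrite kP ?fr // kR.
  + by apply: kE; rewrite fr r1 v2.
  + by rewrite kR ?fr // kP.
  + by apply: kE; rewrite fr r3 v4.
  + by apply: kE; rewrite fr.
(* At most two faces are lost, the 4-face and [P], against four deleted vertices; Euler's formula
   allows exactly that. *)
have sub : faces rot :\ face d1 :\ P \subset k @: A.
  apply/subsetP => r; rewrite !in_setD1 => /and3P [rP rd1 /imsetP [d _ e]].
  suff [d' d'A e'] : exists2 d', d' \in A & face d' = face d.
    by apply/imsetP; exists d'; rewrite // /k e' -e (negbTE rP).
  rewrite {}e {r rP} in rd1.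
  case: (boolP (tail d \in S)) => [dS|]; last by exists d; rewrite ?inA.
  have ff (q : dart G) : head (rot q) \notin S -> exists2 d', d' \in A & face d' = face (rot q).
    by move=> qS; exists (f (rot q)); rewrite ?face_step_face // inA tail_face.
  have corner (p q : dart G) : f p = q -> face q = face d1 -> head (rot p) \notin S ->
      head (rot q) \notin S -> tail d = tail q -> exists2 d', d' \in A & face d' = face d.
    move=> pq qd1 pS qS /(corner_darts pq) [e|e|e].
    - by rewrite e qd1 eqxx in rd1.
    - by rewrite e; apply: ff.
    - by rewrite e -face_rot //; apply: ff.
  have f2 : face d2 = face d1 by rewrite -h1 face_step_face.
  have f3 : face d3 = face d1 by rewrite -h2 face_step_face.
  have f4 : face d4 = face d1 by rewrite -h3 face_step_face.
  have o1 := quad_out1 hq; have o2 := quad_out2 hq.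
  have o3 := quad_out3 hq; have o4 := quad_out4 hq.
  move: dS; rewrite !inE => /orP [/orP [/orP []|]|] /eqP.
  + exact: corner h4 _ o4 o1.
  + exact: corner h1 f2 o1 o2.
  + exact: corner h2 f3 o2 o3.
  + exact: corner h3 f4 o3 o4.
have := subset_leq_card sub; have := euler_faces hcub hcut hrot heul a1.
have := cardsD1 (face d1) (faces rot); have := cardsD1 P (faces rot :\ face d1).
have := card_quad_reduction; case: (_ \in _); case: (_ \in _); clear; lia.
Qed.

Lemma quad_reduction_R0 : exists G' : sgraph, C3CBP G' /\ R0 G G'.
Proof.
exists quad_reduction; split.
  split.
  - exact: cubic_quad_reduction.
  - apply: (cut3_three_connected cubic_quad_reduction cut3_quad_reduction).
    exact: (cubic_card_gt3 cubic_quad_reduction (Sub b1 (quad_out1 hq) : T)).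
  - by exists quad_colour; apply: quad_colourP.
  - exact: planar_quad_reduction.
exists rot, a1, a2, a3, a4, b1, b2, b3, b4; split.
- by split.
- by split; [exact: is_face_four | exact: quad_uniq hq].
- split; [exact: (quad_adj_b1 hq) | exact: (quad_adj_b1 (quad_rot hq))
  | exact: (quad_adj_b1 hq3) | exact: (quad_adj_b1 (quad_rot hq3))].
- by split; [exact: quad_out1 hq | exact: quad_out2 hq | exact: quad_out3 hq | exact: quad_out4 hq].
- by left; exists id; [exists id|].
Qed.

End FourFace.

(** * Uncrossing *)

Record quadrants (G : sgraph) (S : {set G}) (b1 b2 b3 b4 : G) (Q1 Q2 Q3 Q4 : {set G}) : Prop :=
  Quadrants {
    quadrants_disjoint : [/\ [disjoint Q1 & Q2], [disjoint Q1 & Q3], [disjoint Q1 & Q4],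
      [disjoint Q2 & Q3] & [disjoint Q2 & Q4] /\ [disjoint Q3 & Q4]];
    quadrants_cover : Q1 :|: Q2 :|: Q3 :|: Q4 = ~: S;
    quadrants_mem : [/\ b1 \in Q1, b2 \in Q2, b3 \in Q3 & b4 \in Q4];
    quadrants_adj : [/\ edges Q1 Q2 = 1, edges Q2 Q3 = 1, edges Q3 Q4 = 1 & edges Q4 Q1 = 1];
    quadrants_opp : edges Q1 Q3 = 0 /\ edges Q2 Q4 = 0
  }.

Lemma quadrants_rot (G : sgraph) (S : {set G}) (b1 b2 b3 b4 : G) (Q1 Q2 Q3 Q4 : {set G}) :
  quadrants S b1 b2 b3 b4 Q1 Q2 Q3 Q4 -> quadrants S b2 b3 b4 b1 Q2 Q3 Q4 Q1.
Proof.
case=> [[d12 d13 d14 d23 [d24 d34]] co [m1 m2 m3 m4] [e12 e23 e34 e41] [e13 e24]].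
split=> //.
- by rewrite ![[disjoint _ & Q1]]disjoint_sym.
- by rewrite setUC !setUA.
- by rewrite (edgesC Q3).
Qed.

Ltac cells := let z := fresh in move=> z; rewrite !inE; do ?case: (z \in _).

Section Quadrants.
Variable G : sgraph.
Implicit Types (A B X W S P Q : {set G}) (x y : G).
Hypothesis hcub : cubic G.
Hypothesis hcut : cut3 G.

(** The quadrants are the atoms of [X] and [W] outside [S]. Each has one stub, hence at least two
    edges to the others, which makes at least four edges between quadrants. The bounds for [X] and
    [W] add up to 4 and count edges between opposite quadrants twice, so there are none of these,
    and each adjacent pair is left with exactly one edge. *)
Lemma quadrants_exist S (b1 b2 b3 b4 s : G) X W :
  (forall A, A \subset ~: S ->
    edges A S = (b1 \in A) + (b2 \in A) + (b3 \in A) + (b4 \in A)) ->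
  s \in S -> b4 \notin S ->
  splitter S b1 b2 b3 b4 X -> splitter S b2 b3 b4 b1 W ->
  exists Q1 Q2 Q3 Q4, quadrants S b1 b2 b3 b4 Q1 Q2 Q3 Q4.
Proof.
move=> hS sS b4S /and5P [XS b1X b2X b3X /andP [b4X leX]] /and5P [WS b2W b3W b4W /andP [b1W leW]].
have XS' z : (z \in S) && (z \in X) = false.
  by apply/negP => /andP [zS zX]; have := subsetP XS z zX; rewrite inE zS.
have WS' z : (z \in S) && (z \in W) = false.
  by apply/negP => /andP [zS zX]; have := subsetP WS z zX; rewrite inE zS.
pose Q1 := X :\: W; pose Q2 := X :&: W; pose Q3 := W :\: X; pose Q4 := ~: (S :|: X :|: W).
have bool_eq A B : (forall z, (z \in S) && (z \in X) = false -> (z \in S) && (z \in W) = false ->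
    (z \in A) = (z \in B)) -> A = B.
  by move=> h; apply/setP => z; apply: h.
have dj A B : (forall z, (z \in S) && (z \in X) = false -> (z \in S) && (z \in W) = false ->
    (z \in A) && (z \in B) = false) -> [disjoint A & B].
  by move=> h; rewrite -setI_eq0; apply/eqP/setP => z; rewrite !inE h.
have d12 : [disjoint Q1 & Q2] by apply: dj; cells.
have d13 : [disjoint Q1 & Q3] by apply: dj; cells.
have d14 : [disjoint Q1 & Q4] by apply: dj; cells.
have d23 : [disjoint Q2 & Q3] by apply: dj; cells.
have d24 : [disjoint Q2 & Q4] by apply: dj; cells.
have d34 : [disjoint Q3 & Q4] by apply: dj; cells.
have co : Q1 :|: Q2 :|: Q3 :|: Q4 = ~: S by apply: bool_eq; cells.
have m1 : b1 \in Q1 by rewrite inE b1X b1W.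
have m2 : b2 \in Q2 by rewrite inE b2X b2W.
have m3 : b3 \in Q3 by rewrite inE b3X b3W.
have m4 : b4 \in Q4 by rewrite !inE (negbTE b4X) (negbTE b4W) (negbTE b4S).
have cutQ A B1 B2 B3 b : b \in A -> A \subset ~: S -> ~: A = S :|: (B1 :|: (B2 :|: B3)) ->
    [disjoint S & B1 :|: (B2 :|: B3)] -> [disjoint B1 & B2 :|: B3] -> [disjoint B2 & B3] ->
    3 <= (b1 \in A) + (b2 \in A) + (b3 \in A) + (b4 \in A) + (edges A B1 + (edges A B2 + edges A B3)).
  move=> bA AS eA dS d1 d2.
  have sA : s \notin A by apply/negP => /(subsetP AS); rewrite inE sS.
  by have := cut_ge3 hcut bA sA; rewrite eA !edgesUr // hS.
have nE A b B : b \in B -> [disjoint A & B] -> (b \in A) = false.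
  by move=> bB dAB; apply: (disjointFl dAB).
have sub A : (forall z, (z \in S) && (z \in X) = false -> (z \in S) && (z \in W) = false ->
    (z \in A) ==> (z \notin S)) -> A \subset ~: S.
  by move=> h; apply/subsetP => z zA; have := h z (XS' z) (WS' z); rewrite zA inE.
have c1 : 3 <= 1 + (edges Q1 Q2 + (edges Q1 Q3 + edges Q1 Q4)).
  have := @cutQ Q1 Q2 Q3 Q4 b1 m1; rewrite m1 (nE _ _ _ m2 d12) (nE _ _ _ m3 d13) (nE _ _ _ m4 d14).
  by apply; [apply: sub; cells | apply: bool_eq; cells | apply: dj; cells | apply: dj; cells |].
have d21 : [disjoint Q2 & Q1] by rewrite disjoint_sym.
have d31 : [disjoint Q3 & Q1] by rewrite disjoint_sym.
have d41 : [disjoint Q4 & Q1] by rewrite disjoint_sym.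
have d32 : [disjoint Q3 & Q2] by rewrite disjoint_sym.
have d42 : [disjoint Q4 & Q2] by rewrite disjoint_sym.
have d43 : [disjoint Q4 & Q3] by rewrite disjoint_sym.
have c2 : 3 <= 1 + (edges Q2 Q1 + (edges Q2 Q3 + edges Q2 Q4)).
  have := @cutQ Q2 Q1 Q3 Q4 b2 m2; rewrite m2 (nE _ _ _ m1 d21) (nE _ _ _ m3 d23) (nE _ _ _ m4 d24).
  by apply; [apply: sub; cells | apply: bool_eq; cells | apply: dj; cells | apply: dj; cells |].
have c3 : 3 <= 1 + (edges Q3 Q1 + (edges Q3 Q2 + edges Q3 Q4)).
  have := @cutQ Q3 Q1 Q2 Q4 b3 m3; rewrite m3 (nE _ _ _ m1 d31) (nE _ _ _ m2 d32) (nE _ _ _ m4 d34).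
  by apply; [apply: sub; cells | apply: bool_eq; cells | apply: dj; cells | apply: dj; cells |].
have c4 : 3 <= 1 + (edges Q4 Q1 + (edges Q4 Q2 + edges Q4 Q3)).
  have := @cutQ Q4 Q1 Q2 Q3 b4 m4; rewrite m4 (nE _ _ _ m1 d41) (nE _ _ _ m2 d42) (nE _ _ _ m3 d43).
  by apply; [apply: sub; cells | apply: bool_eq; cells | apply: dj; cells | apply: dj; cells |].
have eX : X = Q1 :|: Q2 by apply: bool_eq; cells.
have eX' : ~: (S :|: X) = Q3 :|: Q4 by apply: bool_eq; cells.
have eW : W = Q2 :|: Q3 by apply: bool_eq; cells.
have eW' : ~: (S :|: W) = Q1 :|: Q4 by apply: bool_eq; cells.
move: leX leW; rewrite eX' eW' {1}eX {1}eW !edgesUl // !edgesUr // => leX leW.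
exists Q1, Q2, Q3, Q4.
have [e12 e23 e34 e41] : [/\ edges Q1 Q2 = 1, edges Q2 Q3 = 1, edges Q3 Q4 = 1 & edges Q4 Q1 = 1].
  move: leX leW c1 c2 c3 c4; rewrite !(edgesC Q2 Q1) !(edgesC Q3 Q1) !(edgesC Q3 Q2) !(edgesC Q4).
  by clear; move: (edges _ _) (edges _ _) (edges _ _) (edges _ _) (edges _ _) (edges _ _) => *; split; lia.
split=> //.
move: leX leW c1 c2 c3 c4; rewrite !(edgesC Q2 Q1) !(edgesC Q3 Q1) !(edgesC Q3 Q2) !(edgesC Q4).
by clear; move: (edges _ _) (edges _ _) (edges _ _) (edges _ _) (edges _ _) (edges _ _); lia.
Qed.

(** Submodularity of the cut function; the two sides differ by twice the number of edges between
    [A :\: B] and [B :\: A]. *)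
Lemma edges_submod A B :
  edges (A :&: B) (~: (A :&: B)) + edges (A :|: B) (~: (A :|: B))
    <= edges A (~: A) + edges B (~: B).
Proof.
pose I := A :&: B; pose U := A :\: B; pose V := B :\: A; pose O := ~: (A :|: B).
have dj (C D : {set G}) : (forall z, (z \in C) && (z \in D) = false) -> [disjoint C & D].
  by move=> h; rewrite -setI_eq0; apply/eqP/setP => z; rewrite !inE h.
have eI : ~: I = U :|: (V :|: O) by apply/setP; cells.
have eA : A = I :|: U by apply/setP; cells.
have eA' : ~: A = V :|: O by apply/setP; cells.
have eB : B = I :|: V by apply/setP; cells.
have eB' : ~: B = U :|: O by apply/setP; cells.
have eU : A :|: B = I :|: (U :|: V) by apply/setP; cells.
rewrite -/I -/O eI eA' eB' eU {1}eA {1}eB.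
have dIU : [disjoint I & U] by apply: dj; cells.
have dIV : [disjoint I & V] by apply: dj; cells.
have dUV : [disjoint U & V] by apply: dj; cells.
have dUO : [disjoint U & O] by apply: dj; cells.
have dVO : [disjoint V & O] by apply: dj; cells.
have dI : [disjoint I & U :|: V] by apply: dj; cells.
have dU : [disjoint U & V :|: O] by apply: dj; cells.
rewrite !(edgesUl _ dI, edgesUr _ dU, edgesUl _ dIU, edgesUl _ dIV, edgesUl _ dUV).
rewrite !(edgesUr _ dUO, edgesUr _ dVO) (edgesC V U).
by clear; move: (edges _ _) (edges _ _) (edges _ _) (edges _ _) (edges _ _) (edges _ _); lia.
Qed.

End Quadrants.

(** * Minimal sides of 3-edge-cuts *)

(** With M, s and p the sums of the three kinds of variables, the equation is [3M + 1 = 2(s + p)].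
    By parity M is 1 or 3. For M = 1 it asks for s + p = 2, but p = 0 and s <= 1. For M = 3 it asks
    for s + p = 5, which forces all three stubs and both edges of the path. *)
Lemma three_of_four m1 m2 m3 m4 s1 s2 s3 s4 p12 p23 p34 p41 :
  [/\ m1 <= 1, m2 <= 1, m3 <= 1 & m4 <= 1] ->
  [/\ s1 <= m1, s2 <= m2, s3 <= m3 & s4 <= m4] ->
  [/\ p12 <= m1 * m2, p23 <= m2 * m3, p34 <= m3 * m4 & p41 <= m4 * m1] ->
  3 * (4 + (m1 + m2 + m3 + m4)) = 8 + 2 * (s1 + s2 + s3 + s4) + 2 * (p12 + p23 + p34 + p41) + 3 ->
  [\/ [/\ 0 < p12, 0 < p23 & [/\ 0 < s1, 0 < s2 & 0 < s3]],
      [/\ 0 < p23, 0 < p34 & [/\ 0 < s2, 0 < s3 & 0 < s4]],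
      [/\ 0 < p34, 0 < p41 & [/\ 0 < s3, 0 < s4 & 0 < s1]]
    | [/\ 0 < p41, 0 < p12 & [/\ 0 < s4, 0 < s1 & 0 < s2]]].
Proof.
case; case: m1 => [|[|//]] _; case: m2 => [|[|//]] _; case: m3 => [|[|//]] _; case: m4 => [|[|//]] _;
  case=> ? ? ? ?; case=> ? ? ? ? ?;
  first [ exfalso; lia | by apply: Or41; split; [lia|lia|split; lia]
    | by apply: Or42; split; [lia|lia|split; lia]
    | by apply: Or43; split; [lia|lia|split; lia]
    | by apply: Or44; split; [lia|lia|split; lia] ].
Qed.

Section Ladder.
Variable G : sgraph.
Implicit Types (A B X W P Q : {set G}) (x y : G).
Hypothesis hcub : cubic G.
Hypothesis hcut : cut3 G.

Variables (S P : {set G}) (s : G).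
Hypotheses (sS : s \in S) (SP : S \subset P) (cP : edges P (~: P) = 3).
Hypothesis hmin : forall A, edges A (~: A) = 3 -> #|A| < #|P| -> #|A| <= 1.

(** Stated as a count on sets, so that coinciding [b_i] enter with their multiplicity. *)
Definition stubs_only (b1 b2 b3 b4 : G) : Prop := forall A, A \subset ~: S ->
  edges A S = (b1 \in A) + (b2 \in A) + (b3 \in A) + (b4 \in A).

Lemma stubs_only_rot b1 b2 b3 b4 : stubs_only b1 b2 b3 b4 -> stubs_only b2 b3 b4 b1.
Proof. by move=> h A /h ->; rewrite -!addnA addnC !addnA. Qed.

Lemma card_le1_adj b1 b2 A B : b1 \in A -> b2 \in B -> #|A| <= 1 -> #|B| <= 1 ->
  0 < edges A B -> adj b1 b2.
Proof.
move=> b1A b2B /card_le1_eqP hA /card_le1_eqP hB /edges_gt0P [x [y [xA yB]]].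
by rewrite (hA _ _ xA b1A) (hB _ _ yB b2B).
Qed.

Section One.
Variables (b1 b2 b3 b4 : G) (Q1 Q2 Q3 Q4 : {set G}).
Hypothesis hS : stubs_only b1 b2 b3 b4.
Hypothesis hQ : quadrants S b1 b2 b3 b4 Q1 Q2 Q3 Q4.

Lemma quadrant_sub : [/\ Q1 \subset ~: S, Q2 \subset ~: S, Q3 \subset ~: S & Q4 \subset ~: S].
Proof.
by rewrite -(quadrants_cover hQ); split; apply/subsetP => z zQ; rewrite !inE zQ ?orbT.
Qed.

Lemma quadrant_cut : edges Q1 (~: Q1) = 3.
Proof.
have [[d12 d13 d14 d23 [d24 d34]] co [m1 m2 m3 m4] [e12 e23 e34 e41] [e13 e24]] := hQ.
have [q1 q2 q3 q4] := quadrant_sub.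
have dS A : A \subset ~: S -> [disjoint S & A] by rewrite disjoint_sym disjoints_subset.
have e : ~: Q1 = S :|: (Q2 :|: (Q3 :|: Q4)).
  apply/setP => z; have := in_setC z S; rewrite -co !inE.
  have := disjoint_setI0 d12 => /setP /(_ z); have := disjoint_setI0 d13 => /setP /(_ z).
  have := disjoint_setI0 d14 => /setP /(_ z); rewrite !inE.
  by case: (z \in Q1); case: (z \in Q2); case: (z \in Q3); case: (z \in Q4); case: (z \in S).
rewrite e edgesUr; last by apply: dS; rewrite !subUset q2 q3 q4.
rewrite edgesUr; last by rewrite -setI_eq0 setIUr setU_eq0 !setI_eq0 d23.
rewrite edgesUr // (hS q1) e12 e13 (edgesC Q1 Q4) e41 m1.
by rewrite (disjointFl d12) // (disjointFl d13) // (disjointFl d14).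
Qed.

(** If [Q1 :|: P] is not everything and [Q1 :&: P] is not empty, both have at least three cut edges,
    and submodularity leaves exactly three to the intersection. It misses [s], hence is smaller than
    [P]. *)
Lemma quadrant_small : ~: P \subset Q1 \/ #|Q1 :&: P| <= 1.
Proof.
have [q1 _ _ _] := quadrant_sub.
have sQ : s \notin Q1 by apply/negP => /(subsetP q1); rewrite inE sS.
have sP : s \in P := subsetP SP _ sS.
case: (boolP (~: P \subset Q1)) => [|/subsetPn [y yP yQ]]; [by left | right].
rewrite inE in yP.
case: (set_0Vmem (Q1 :&: P)) => [->|[x xQP]]; first by rewrite cards0.
have s1 : s \notin Q1 :&: P by rewrite inE negb_and sQ.
have s2 : s \in Q1 :|: P by rewrite inE sP orbT.
have y2 : y \notin Q1 :|: P by rewrite inE negb_or yQ.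
have c1 := cut_ge3 hcut xQP s1; have c2 := cut_ge3 hcut s2 y2.
have := edges_submod Q1 P; rewrite quadrant_cut cP => sub.
apply: hmin; first by move: c1 c2 sub; clear; lia.
apply: proper_card; apply/properP; split; first exact: subsetIr.
by exists s.
Qed.

Lemma quadrant_in_card : Q1 \subset P -> #|Q1| <= 1.
Proof.
move=> QP; apply: (hmin quadrant_cut); apply: proper_card; apply/properP; split=> //.
have [q1 _ _ _] := quadrant_sub.
exists s; first exact: (subsetP SP).
by apply/negP => /(subsetP q1); rewrite inE sS.
Qed.

End One.

Section Two.
Variables (b1 b2 b3 b4 : G) (Q1 Q2 Q3 Q4 : {set G}).
Hypothesis hS : stubs_only b1 b2 b3 b4.
Hypothesis hQ : quadrants S b1 b2 b3 b4 Q1 Q2 Q3 Q4.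

(** The other three quadrants lie in [P] and are sides of 3-edge-cuts that miss [S], so by
    minimality each is a single vertex. *)
Lemma quadrant_big_ladder : ~: P \subset Q4 -> adj b1 b2 /\ adj b2 b3.
Proof.
move=> PQ4.
have [[d12 d13 d14 d23 [d24 d34]] co [m1 m2 m3 m4] [e12 e23 e34 e41] [e13 e24]] := hQ.
have sub Q : [disjoint Q & Q4] -> Q \subset P.
  rewrite disjoints_subset => /subset_trans; apply.
  by rewrite -(setCK P) setCS.
have k1 := quadrant_in_card hS hQ (sub _ d14).
have k2 := quadrant_in_card (stubs_only_rot hS) (quadrants_rot hQ) (sub _ d24).
have k3 := quadrant_in_card (stubs_only_rot (stubs_only_rot hS))
  (quadrants_rot (quadrants_rot hQ)) (sub _ d34).
by split; [apply: (card_le1_adj m1 m2 k1 k2) | apply: (card_le1_adj m2 m3 k2 k3)];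
  rewrite ?e12 ?e23.
Qed.

End Two.

Variables (b1 b2 b3 b4 : G) (Q1 Q2 Q3 Q4 : {set G}).
Hypothesis hS : stubs_only b1 b2 b3 b4.
Hypothesis hQ : quadrants S b1 b2 b3 b4 Q1 Q2 Q3 Q4.
Hypotheses (cS : #|S| = 4) (eSS : edges S S = 8).

Lemma ladder : [\/ adj b1 b2 /\ adj b2 b3, adj b2 b3 /\ adj b3 b4,
  adj b3 b4 /\ adj b4 b1 | adj b4 b1 /\ adj b1 b2].
Proof.
have hS2 := stubs_only_rot hS; have hQ2 := quadrants_rot hQ.
have hS3 := stubs_only_rot hS2; have hQ3 := quadrants_rot hQ2.
have hS4 := stubs_only_rot hS3; have hQ4 := quadrants_rot hQ3.
case: (quadrant_small hS hQ) => [/(quadrant_big_ladder hS2 hQ2) ?|k1]; first exact: Or42.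
case: (quadrant_small hS2 hQ2) => [/(quadrant_big_ladder hS3 hQ3) ?|k2]; first exact: Or43.
case: (quadrant_small hS3 hQ3) => [/(quadrant_big_ladder hS4 hQ4) ?|k3]; first exact: Or44.
case: (quadrant_small hS4 hQ4) => [/(quadrant_big_ladder hS hQ) ?|k4]; first exact: Or41.
have [[d12 d13 d14 d23 [d24 d34]] co [m1 m2 m3 m4] [e12 e23 e34 e41] [e13 e24]] := hQ.
have [q1 q2 q3 q4] := quadrant_sub hQ.
pose P1 := Q1 :&: P; pose P2 := Q2 :&: P; pose P3 := Q3 :&: P; pose P4 := Q4 :&: P.
pose R := P1 :|: (P2 :|: (P3 :|: P4)).
have djI Q Q' : [disjoint Q & Q'] -> [disjoint Q :&: P & Q' :&: P].
  by apply: disjointW; apply: subsetIl.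
have D34 : [disjoint P3 & P4] by apply: djI.
have D2 : [disjoint P2 & P3 :|: P4] by rewrite -setI_eq0 setIUr setU_eq0 !setI_eq0 !djI.
have D1 : [disjoint P1 & P2 :|: (P3 :|: P4)].
  by rewrite -setI_eq0 !setIUr !setU_eq0 !setI_eq0 !djI.
have RS : R \subset ~: S.
  by rewrite !subUset !(subset_trans (subsetIl _ _)).
have eP : P = S :|: R.
  have eR : R = ~: S :&: P by rewrite -co !setIUl -!setUA.
  by rewrite eR setUIr setUCr setTI; apply/esym/setUidPr.
have dSR : [disjoint S & R] by rewrite disjoint_sym disjoints_subset.
have bR b Q : b \in Q -> Q :&: P \subset R -> (b \in R) = (b \in Q :&: P).
  move=> bQ sR; apply/idP/idP => [bR|/(subsetP sR) //].
  by rewrite inE bQ eP inE bR orbT.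
have sR1 : P1 \subset R by apply: subsetUl.
have sR2 : P2 \subset R by rewrite /R setUCA subsetUl.
have sR3 : P3 \subset R by rewrite /R !(setUCA _ P3) subsetUl.
have sR4 : P4 \subset R by rewrite /R !setUA subsetUr.
have mem_card b Q : (b \in Q : nat) <= #|Q|.
  by case bQ: (b \in Q) => //; apply/card_gt0P; exists b.
have ee0 Q : #|Q| <= 1 -> edges Q Q = 0.
  move=> le1; rewrite edges_sum big1 // => x xQ; apply/eqP; rewrite -leqn0.
  by apply: leq_trans (edges1_self x Q) _; move: le1; rewrite (cardsD1 x Q) xQ.
have opp Q Q' : edges Q Q' = 0 -> edges (Q :&: P) (Q' :&: P) = 0.
  by move=> e; apply/eqP; rewrite -leqn0 -e; apply: edgesS; apply: subsetIl.
(* No quadrant contains the complement of [P], so [P] is [S] with at most one vertex from each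
   quadrant. Its degree sum is the equation of [three_of_four]. *)
have := edges_split hcub P P; rewrite cP {1 2 3}eP.
rewrite !(edgesUl _ dSR) !(edgesUr _ dSR) eSS (edgesC S R) (hS RS).
rewrite (bR _ _ m1 sR1) (bR _ _ m2 sR2) (bR _ _ m3 sR3) (bR _ _ m4 sR4).
rewrite cardsU (disjoint_setI0 dSR) cards0 subn0 cS.
have -> : #|R| = #|P1| + #|P2| + #|P3| + #|P4|.
  rewrite cardsU (disjoint_setI0 D1) cards0 subn0 cardsU (disjoint_setI0 D2) cards0 subn0.
  by rewrite cardsU (disjoint_setI0 D34) cards0 subn0 !addnA.
have -> : edges R R = 2 * (edges P1 P2 + edges P2 P3 + edges P3 P4 + edges P4 P1).
  rewrite !(edgesUl _ D1, edgesUl _ D2, edgesUl _ D34) !(edgesUr _ D1, edgesUr _ D2, edgesUr _ D34).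
  rewrite !ee0 // (edgesC P3 P1) (edgesC P4 P2) (opp _ _ e13) (opp _ _ e24).
  rewrite (edgesC P2 P1) (edgesC P3 P2) (edgesC P4 P3) (edgesC P1 P4).
  by clear; lia.
move=> count.
have m_le : [/\ #|P1| <= 1, #|P2| <= 1, #|P3| <= 1 & #|P4| <= 1] by [].
have s_le : [/\ (b1 \in P1 : nat) <= #|P1|, (b2 \in P2 : nat) <= #|P2|,
    (b3 \in P3 : nat) <= #|P3| & (b4 \in P4 : nat) <= #|P4|] by [].
have p_le : [/\ edges P1 P2 <= #|P1| * #|P2|, edges P2 P3 <= #|P2| * #|P3|,
    edges P3 P4 <= #|P3| * #|P4| & edges P4 P1 <= #|P4| * #|P1|].
  by split; apply: edges_card_le.
have := three_of_four m_le s_le p_le; case.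
- by move: count; rewrite -/P1 -/P2 -/P3 -/P4; clear; lia.
- case=> g12 g23 [i1 i2 i3]; apply: Or41; rewrite !lt0b in i1 i2 i3.
  by split; [apply: card_le1_adj i1 i2 k1 k2 g12 | apply: card_le1_adj i2 i3 k2 k3 g23].
- case=> g12 g23 [i1 i2 i3]; apply: Or42; rewrite !lt0b in i1 i2 i3.
  by split; [apply: card_le1_adj i1 i2 k2 k3 g12 | apply: card_le1_adj i2 i3 k3 k4 g23].
- case=> g12 g23 [i1 i2 i3]; apply: Or43; rewrite !lt0b in i1 i2 i3.
  by split; [apply: card_le1_adj i1 i2 k3 k4 g12 | apply: card_le1_adj i2 i3 k4 k1 g23].
- case=> g12 g23 [i1 i2 i3]; apply: Or44; rewrite !lt0b in i1 i2 i3.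
  by split; [apply: card_le1_adj i1 i2 k4 k1 g12 | apply: card_le1_adj i2 i3 k1 k2 g23].
Qed.

End Ladder.

(** * A cube minus a vertex *)

Section CubeMinusVertex.
Variable G : sgraph.
Implicit Types (A B X : {set G}) (x y : G).

Variable c : G -> bool.
Hypothesis hc : forall x y, adj x y -> c x != c y.
Hypothesis hcub : cubic G.
Hypothesis hcut : cut3 G.
Variable rot : dart G -> dart G.
Hypothesis hrot : rotation rot.
Hypothesis heul : euler_sphere rot.
Hypothesis hord : 8 < #|G|.

Lemma cubic_nbrs x p q r : uniq [:: p; q; r] -> adj x p -> adj x q -> adj x r ->
  forall y, adj x y = (y \in [:: p; q; r]).
Proof.
move=> u xp xq xr y.
have e : [set z in [:: p; q; r]] = [set z | adj x z].
  apply/eqP; rewrite eqEcard hcub cardsE (card_uniqP u) andbT.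
  by apply/subsetP => z; rewrite !inE => /or3P [] /eqP ->.
by have := in_set (mem [:: p; q; r]) y; rewrite e inE.
Qed.

Lemma cubic_third x p q : p != q -> adj x p -> adj x q ->
  exists r, uniq [:: p; q; r] /\ forall y, adj x y = (y \in [:: p; q; r]).
Proof.
move=> pq xp xq.
have [r] : exists r, r \in [set y | adj x y] :\: [set p; q].
  apply/card_gt0P; rewrite cardsD hcub subn_gt0.
  apply: leq_ltn_trans (subset_leq_card (subsetIr _ _)) _.
  by rewrite cards2; case: (_ != _).
rewrite !inE negb_or => /andP [/andP [rp rq] xr].
have u : uniq [:: p; q; r] by rewrite /= !inE negb_or pq eq_sym rp eq_sym rq.
by exists r; split; last exact: cubic_nbrs.
Qed.

Variables a1 a2 a3 a4 b1 b2 b3 b4 : G.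
Hypothesis hq : quad a1 a2 a3 a4 b1 b2 b3 b4.
Hypotheses (b12 : adj b1 b2) (b23 : adj b2 b3) (n13 : b1 != b3) (n24 : b2 != b4).

(** Listed in the order of [R4]: [a2] is [j], its neighbours [a1], [a3], [b2] are the [h_i], and
    [a4], [b1], [b3] are the [x_i]. The missing corner of the cube is the one opposite to [a2]. *)
Let s := [:: a2; a1; a3; b2; a4; b1; b3].
Let S := [set v in s].

Let uniq_s : uniq s.
Proof.
have := quad_uniq hq; have := quad_out1 hq; have := quad_out2 hq; have := quad_out3 hq.
have n12 := b12_neq hc hq; have n23 := b12_neq hc (quad_rot hq).
move: n12 n23 n13; rewrite /s /= !inE !negb_or !(eq_sym b1) !(eq_sym b2) !(eq_sym b3).
move=> -> -> -> /andP [/andP [/andP [-> ->] ->] ->] /andP [/andP [/andP [-> ->] ->] ->].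
move=> /andP [/andP [/andP [-> ->] ->] ->] /= /and4P [/and3P [n12 -> ->] /andP [-> ->] -> _].
by rewrite eq_sym n12.
Qed.

Let cs : [/\ c a2 = c b1, c a4 = c b1 & c b3 = c b1].
Proof.
have q2 := quad_rot hq; have q4 := quad_rot (quad_rot q2).
have h1 := hc (quad_adj_b1 hq); have h12 := hc b12; have h23 := hc b23.
have ha12 : c a1 != c a2 by apply: hc; rewrite (quad_adj1 hq) !inE eqxx orbT.
have ha14 : c a1 != c a4 by apply: hc; rewrite (quad_adj1 hq) !inE eqxx.
split.
- by move: h1 ha12; do 3 case: (c _).
- by move: h1 ha14; do 3 case: (c _).
- by move: h12 h23; do 3 case: (c _).
Qed.

Lemma cube_minus_vertex_R4 : exists G' : sgraph, C3CBP G' /\ R4 G G'.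
Proof.
have [ca2 ca4 cb3] := cs.
have q2 := quad_rot hq; have q3 := quad_rot q2; have q4 := quad_rot q3.
have N1 := quad_adj1 hq; have N2 := quad_adj2 hq; have N3 := quad_adj3 hq; have N4 := quad_adj4 hq.
have b21 : adj b2 b1 by rewrite adj_sym.
have b32 : adj b3 b2 by rewrite adj_sym.
have a1b1 : adj b1 a1 by rewrite adj_sym; apply: quad_adj_b1 hq.
have a2b2 : adj b2 a2 by rewrite adj_sym; apply: quad_adj_b1 q2.
have a3b3 : adj b3 a3 by rewrite adj_sym; apply: quad_adj_b1 q3.
have := uniq_s; rewrite /s /= !inE !negb_or andbT.
case/and5P => /and5P [na21 na23 na2b2 na24 /andP [na2b1 na2b3]]
  /and5P [na13 na1b2 na14 na1b1 na1b3] /and4P [na3b2 na34 na3b1 na3b3]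
  /and3P [na4b2 nb21 nb23] /andP [/andP [na4b1 na4b3] nb13].
have [y2 [u2 M1]] := cubic_third na1b2 a1b1 b12.
have [y3 [u3 M3]] := cubic_third na3b2 a3b3 b32.
have M2 : forall y, adj b2 y = (y \in [:: a2; b1; b3]).
  apply: cubic_nbrs => //.
  by rewrite /= !inE negb_or na2b1 na2b3 nb13.
have nb14 : b1 != b4 by rewrite eq_sym; exact: (b12_neq hc q4).
have nb34 : b3 != b4 by exact: (b12_neq hc q3).
have b4s : b4 \notin s.
  have := quad_out4 hq; rewrite /s !inE !negb_or => /andP [/andP [/andP [-> ->] ->] ->].
  by rewrite !(eq_sym b4) n24 nb14 nb34.
(* The colours leave only [a1], [b2] and [a3]. The first two are the other neighbours of [b1], and
   [b1] is not among the three neighbours of [a3]. *)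
have y2s : y2 \notin s.
  have by2 : adj b1 y2 by rewrite M1 !inE eqxx !orbT.
  have cy2 := hc by2; move: u2; rewrite /= !inE !negb_or !andbT => /andP [/andP [_ y2a1] y2b2].
  have nc z : c z = c b1 -> y2 != z by move=> cz; apply: contra_neq cy2 => ->.
  rewrite (nc _ ca2) (nc _ ca4) (nc b1) // (nc _ cb3) (eq_sym y2 a1) y2a1 (eq_sym y2 b2) y2b2 /= andbT.
  apply/eqP => e; move: by2; rewrite e adj_sym N3 !inE.
  by rewrite !(eq_sym b1) (negbTE na2b1) (negbTE na4b1) eq_sym (negbTE nb13).
have y3s : y3 \notin s.
  have by3 : adj b3 y3 by rewrite M3 !inE eqxx !orbT.
  have cy3 := hc by3; move: u3; rewrite /= !inE !negb_or !andbT => /andP [/andP [_ y3a3] y3b2].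
  have nc z : c z = c b1 -> y3 != z by move=> cz; apply: contra_neq cy3 => ->; rewrite cb3 cz.
  rewrite (nc _ ca2) (nc _ ca4) (nc b1) // (nc _ cb3) (eq_sym y3 a3) y3a3 (eq_sym y3 b2) y3b2 /= andbT.
  apply/eqP => e; move: by3; rewrite e adj_sym N1 !inE.
  by rewrite !(eq_sym b3) (negbTE na2b3) (negbTE na4b3) (negbTE nb13).
pose E := [:: (a2, a1); (a2, a3); (a2, b2); (a4, a1); (a4, a3); (b1, a1); (b1, b2);
  (b3, a3); (b3, b2)].
have EA : all (fun e => adj e.1 e.2) E.
  by rewrite /E /= !N2 !N4 a1b1 b12 a3b3 b32 !inE !eqxx !orbT.
have adjE : {in s &, forall u v, adj u v = ((u, v) \in E) || ((v, u) \in E)}.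
  move=> u v us vs; apply/idP/idP; last first.
    by case/orP => /(allP EA) //=; rewrite adj_sym.
  have vn z : z \notin s -> v <> z by move=> zs vz; rewrite -vz vs in zs.
  move: us; rewrite /s !inE -!orbA => /or4P [||| /or4P []] /eqP ->;
    rewrite ?N1 ?N2 ?N3 ?N4 ?M1 ?M2 ?M3 !inE => /or3P [] /eqP e; rewrite ?e ?eqxx ?orbT //;
    by case: (vn _ _ e).
have memS x : (x \in S) = (x \in s) by rewrite in_set.
have cardS : #|S| = 7 by rewrite cardsE (card_uniqP uniq_s).
have cS : edges S (~: S) = 3.
  pose F := [set a1; a2; a3; a4]; pose B := [set b1; b2; b3].
  have eS : S = F :|: B.
    apply/setP => x; rewrite memS /s !inE.
    by do 7 case: (x == _).
  have BF : B \subset ~: F.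
    by rewrite !subUset !sub1set !in_setC (quad_out1 hq) (quad_out2 hq) (quad_out3 hq).
  have dFB : [disjoint F & B] by rewrite disjoint_sym disjoints_subset.
  have d1 : [disjoint [set b1] & [set b2]] by rewrite disjoints1 inE eq_sym.
  have d2 : [disjoint [set b1; b2] & [set b3]].
    by rewrite disjoint_sym disjoints1 !inE negb_or !(eq_sym b3) nb13.
  have nab : adj b1 b3 = false by apply/negP => /hc; rewrite cb3 eqxx.
  have [B1 B2 B3] : [/\ b1 \in B, b2 \in B & b3 \in B] by rewrite !inE !eqxx !orbT.
  have B4 : (b4 \in B) = false.
    by apply: contraNF b4s; rewrite /s !inE => /orP [/orP []|] /eqP ->; rewrite eqxx ?orbT.
  have := edges_split hcub S S; rewrite cardS {1 2}eS.
  rewrite !(edgesUl _ dFB) !(edgesUr _ dFB) (edges_quad hcub hq) (edgesC F B).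
  rewrite (edges_to_quad hq BF) B1 B2 B3 B4.
  rewrite !(edgesUl _ d2) !(edgesUr _ d2) !(edgesUl _ d1) !(edgesUr _ d1).
  rewrite !edges11 !adj_irrefl b12 b23 b21 b32 (adj_sym b3 b1) nab.
  by clear; lia.
(* In a graph of order 8, such as the cube, a single vertex would be left outside [S]. *)
have gt1 : 1 < #|~: S| by have := cardsC S; rewrite cardS; move: hord; clear; lia.
have outE x u : x \in s -> u \notin s -> adj x u ->
    [\/ x = a4 /\ u = b4, x = b1 /\ u = y2 | x = b3 /\ u = y3].
  move=> xs us; have un z : z \in s -> u <> z by move=> zs uz; rewrite -uz (negbTE us) in zs.
  have [s1 s2 s3 s4] : [/\ a1 \in s, a2 \in s, a3 \in s & a4 \in s] by rewrite /s !inE !eqxx !orbT.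
  have [t1 t2 t3] : [/\ b1 \in s, b2 \in s & b3 \in s] by rewrite /s !inE !eqxx !orbT.
  move: xs; rewrite /s !inE => /or4P [||| /or4P []] /eqP ->;
    rewrite ?N1 ?N2 ?N3 ?N4 ?M1 ?M2 ?M3 !inE => /or3P [] /eqP e;
    first [ by case: (un _ s1 e) | by case: (un _ s2 e) | by case: (un _ s3 e)
      | by case: (un _ s4 e) | by case: (un _ t1 e) | by case: (un _ t2 e)
      | by case: (un _ t3 e) | by apply: Or31 | by apply: Or32 | by apply: Or33 ].
pose N := [set b4; y2; y3].
have [ay1 ay2 ay3] : [/\ adj a4 b4, adj b1 y2 & adj b3 y3].
  by rewrite N4 M1 M3 !inE !eqxx !orbT.
have hN u : u \notin S -> (u \in N) = [exists x in S, adj x u].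
  rewrite memS => us; apply/idP/existsP => [|[x /andP []]].
    rewrite !inE => /orP [/orP []|] /eqP ->.
    - by exists a4; rewrite memS /s !inE eqxx !orbT.
    - by exists b1; rewrite memS /s !inE eqxx !orbT.
    - by exists b3; rewrite memS /s !inE eqxx !orbT.
  by rewrite memS => xs /(outE _ _ xs us) [] [_ ->]; rewrite !inE eqxx ?orbT.
have cout x y : x \in S -> y \notin S -> adj x y -> c x = c b1.
  by rewrite !memS => xs ys /(outE _ _ xs ys) [] [-> _].
have [G' [G'ok G'iso]] := contraction_C3CBP hc hcub hcut hrot heul cS gt1 hN cout.
exists G'; split=> //.
exists a2, a1, a3, b2, a4, b1, b3, b4, y2, y3; split=> //.
by rewrite !memS.
Qed.

End CubeMinusVertex.

(** * Choice of the minimal cut and of the reduction *)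

Theorem theorem8p8 (G : sgraph) (hG : C3CBP G) (hord : 8 < #|G|) :
  exists G' : sgraph, C3CBP G' /\ (R0 G G' \/ R4 G G').
Proof.
case: hG => hcub h3 [c hc] [rot [hrot heul]].
have hcut := three_connected_cut3 hcub h3.
have [x0] : exists x : G, x \in G by apply/card_gt0P; apply: leq_trans hord.
move=> _; pose nontrivial (A : {set G}) := (edges A (~: A) == 3) && (1 < #|A|).
(* The complement of a vertex is a nontrivial side, so a minimal one exists. *)
have nt0 : nontrivial (~: [set x0]).
  rewrite /nontrivial setCK edgesC; have := edges_split hcub [set x0] [set x0].
  rewrite edges11 adj_irrefl cards1 add0n => ->.
  by have := cardsC1 x0; rewrite /= => ->; move: hord; case: #|G| => [|[|[]]].
case: (arg_minnP (fun A : {set G} => #|A|) nt0) => P /andP [/eqP cP gtP] minP.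
have hmin (A : {set G}) : edges A (~: A) = 3 -> #|A| < #|P| -> #|A| <= 1.
  move=> cA ltA; rewrite leqNgt; apply/negP => gtA.
  by have := minP A; rewrite /nontrivial cA gtA leqNgt ltA => /(_ isT).
have [x [y [xP]]] : exists x y, [/\ x \in P, y \in ~: P & adj x y].
  by apply: edges_gt0P; rewrite cP.
rewrite inE => yP _.
have [d1 [f4 inP]] := four_face hc hcub hcut hrot heul xP yP cP gtP.
pose d2 := face_step rot d1; pose d3 := face_step rot d2; pose d4 := face_step rot d3.
have e1 : face_step rot d1 = d2 by [].
have e2 : face_step rot d2 = d3 by [].
have e3 : face_step rot d3 = d4 by [].
have e4 : face_step rot d4 = d1 by [].
have hq := quad_of_face hc hcub hrot e1 e2 e3 e4.
set a1 := tail d1 in hq; set a2 := tail d2 in hq; set a3 := tail d3 in hq; set a4 := tail d4 in hq.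
pose S := [set a1; a2; a3; a4].
have SP : S \subset P.
  rewrite !subUset !sub1set; have := inP 0; have := inP 1; have := inP 2; have := inP 3.
  by rewrite /= => -> -> -> ->.
have [/forallP nosp|/forallPn [X spX]] :=
  boolP [forall X, ~~ splitter S (head (rot d1)) (head (rot d2)) (head (rot d3)) (head (rot d4)) X].
  have [G' [G'ok r]] := quad_reduction_R0 hc hcub hcut hrot e1 e2 e3 e4 heul hord nosp.
  by exists G'; split; [|left].
(* The second application of the reduction is the first one for the same face read from [d2]. *)
have [/forallP nosp|/forallPn [W spW]] :=
  boolP [forall W, ~~ splitter [set a2; a3; a4; a1] (head (rot d2)) (head (rot d3)) (head (rot d4)) (head (rot d1)) W].
  have [G' [G'ok r]] := quad_reduction_R0 hc hcub hcut hrot e2 e3 e4 e1 heul hord nosp.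
  by exists G'; split; [|left].
rewrite negbK in spX; rewrite negbK set4_rot in spW.
have hS : stubs_only S (head (rot d1)) (head (rot d2)) (head (rot d3)) (head (rot d4)).
  by move=> A AS; apply: (edges_to_quad hq).
have a1S : a1 \in S by rewrite !inE eqxx.
have [Q1 [Q2 [Q3 [Q4 hQ]]]] := quadrants_exist hcut hS a1S (quad_out4 hq) spX spW.
(* Opposite [b_i] lie in disjoint quadrants; [quad] and the colouring alone would let them
   coincide. *)
have [[_ d13 _ _ [d24 _]] _ [m1 m2 m3 m4] _ _] := hQ.
have n13 : head (rot d1) != head (rot d3).
  by apply: contraTneq m1 => ->; rewrite (disjointFl d13).
have n24 : head (rot d2) != head (rot d4).
  by apply: contraTneq m2 => ->; rewrite (disjointFl d24).
have q2 := quad_rot hq; have q3 := quad_rot q2; have q4 := quad_rot q3.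
have R4ex := cube_minus_vertex_R4 hc hcub hcut hrot heul hord.
suff [G' [G'ok r]] : exists G', C3CBP G' /\ R4 G G' by exists G'; split; [|right].
case: (ladder hcub hcut a1S SP cP hmin hS hQ (card_quad hq) (edges_quad hcub hq)) => -[b b'].
- exact: R4ex hq b b' n13 n24.
- by apply: (R4ex _ _ _ _ _ _ _ _ q2 b b' n24); rewrite eq_sym.
- by apply: (R4ex _ _ _ _ _ _ _ _ q3 b b'); rewrite eq_sym.
- by apply: (R4ex _ _ _ _ _ _ _ _ q4 b b' _ n13); rewrite eq_sym.
Qed.
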